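(* Let $m\ge 2$, let $J\subseteq\mathbb{R}$ be an interval, and let $c_i:J\to(-1,0)\cup(0,1)$ and $b_i:J\to\mathbb{R}$, $i=1,\dots,m$, be $C^1$ functions such that, for some $\delta>0$, $\frac{d|c_i|}{d\lambda}(\lambda)\le-\delta$ for all $\lambda\in J$ and all $i$. Then there is a continuous function $\varepsilon_0:J\to(0,\infty)$, depending only on $J$ and the functions $c_i,b_i$, such that the following holds. Let $g_i:[0,1]\times J\to\mathbb{R}$, $i=1,\dots,m$, be $C^2$ functions all of whose partial derivatives of order $0$, $1$ and $2$ in $(x,\lambda)$ are bounded in absolute value by $\varepsilon_0(\lambda)$ at every $(x,\lambda)\in[0,1]\times J$, and suppose that for every $\lambda\in J$ the maps $$f_{i,\lambda}(x)=c_i(\lambda)x+b_i(\lambda)+g_i(x,\lambda),\qquad i=1,\dots,m,$$ generate a dynamically defined Cantor set $C_\lambda$. Then for any compact set $K\subset\mathbb{R}$ with $$\dim_H(K)+\dim_H(C_\lambda)>1\quad\text{for all }\lambda\in J,$$ the sumset $K+C_\lambda=\{x+y: x\in K,\ y\in C_\lambda\}$ has positive Lebesgue measure for Lebesgue-a.e. $\lambda\in J$.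
   Context: $\dim_H$ is Hausdorff dimension. Maps $f_1,\dots,f_m$ generate a dynamically defined Cantor set $C$ if each $f_i:[0,1]\to[0,1]$ is a contraction that is a diffeomorphism onto its image (so $0<|f_i'|<1$ on $[0,1]$), the images $f_i([0,1])$ are pairwise disjoint, and $C=\bigcap_{n\ge0}I_n$ where $I_0=[0,1]$ and $I_{n+1}=\bigcup_{i=1}^m f_i(I_n)$. *)

(* Defs.v *)
From HB Require Import structures.
From mathcomp Require Import all_boot all_order all_algebra.
From mathcomp Require Import all_classical all_reals all_analysis.

Set Implicit Arguments.
Unset Strict Implicit.
Unset Printing Implicit Defensive.

Import Order.TTheory GRing.Theory Num.Theory.
Import numFieldNormedType.Exports.

Local Open Scope classical_set_scope.
Local Open Scope ring_scope.

(* Calculus relative to a set [D], in practice an interval that may contain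
   its endpoints: derivatives at an endpoint are one-sided. *)

Definition diff_quotient (R : realType) (f : R -> R) (x y : R) : R :=
  (f y - f x) / (y - x).

Definition derivable_within (R : realType) (D : set R) (f : R -> R) (x : R) :
    Prop :=
  cvg (diff_quotient f x @ within D x^').

(* Meaningful only under [derivable_within D f x]. *)
Definition derive_within (R : realType) (D : set R) (f : R -> R) (x : R) : R :=
  lim (diff_quotient f x @ within D x^').

Definition C1_on (R : realType) (D : set R) (f : R -> R) : Prop :=
  (forall x, D x -> derivable_within D f x) /\
  {within D, continuous (derive_within D f)}.

Definition partial1 (R : realType) (A : set R) (g : R * R -> R) (p : R * R) :
    R :=
  derive_within A (fun x => g (x, p.2)) p.1.

Definition partial2 (R : realType) (B : set R) (g : R * R -> R) (p : R * R) :
    R :=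
  derive_within B (fun y => g (p.1, y)) p.2.

(* Continuity of [g] itself follows from that of its two partial derivatives
   when [A] and [B] are intervals. *)
Definition C1_on2 (R : realType) (A B : set R) (g : R * R -> R) : Prop :=
  [/\ forall p, (A `*` B) p ->
        derivable_within A (fun x => g (x, p.2)) p.1 /\
        derivable_within B (fun y => g (p.1, y)) p.2,
      {within A `*` B, continuous (partial1 A g)}
    & {within A `*` B, continuous (partial2 B g)}].

Definition C2_on2 (R : realType) (A B : set R) (g : R * R -> R) : Prop :=
  [/\ C1_on2 A B g, C1_on2 A B (partial1 A g) & C1_on2 A B (partial2 B g)].

Definition partials_upto2 (R : realType) (A B : set R) (g : R * R -> R) :
    seq (R * R -> R) :=
  [:: g;
      partial1 A g;
      partial2 B g;
      partial1 A (partial1 A g);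
      partial1 A (partial2 B g);
      partial2 B (partial1 A g);
      partial2 B (partial2 B g)].

Definition contraction_on (R : realType) (D : set R) (f : R -> R) : Prop :=
  exists2 k : R, k < 1 &
    forall x y, D x -> D y -> `|f x - f y| <= k * `|x - y|.

Definition diffeo_onto_image (R : realType) (D : set R) (f : R -> R) : Prop :=
  C1_on D f /\
  exists2 h : R -> R, C1_on (f @` D) h & forall x, D x -> h (f x) = x.

Fixpoint cantor_stage (R : realType) (m : nat) (f : 'I_m -> R -> R) (n : nat) :
    set R :=
  if n is n'.+1 then \bigcup_(i in [set: 'I_m]) (f i @` cantor_stage f n')
  else `[0, 1].

Definition generates_cantor_set (R : realType) (m : nat) (f : 'I_m -> R -> R)
    (C : set R) : Prop :=
  [/\ forall i, [/\ set_fun `[0, 1] `[0, 1] (f i),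
                    contraction_on `[0, 1] (f i)
                  & diffeo_onto_image `[0, 1] (f i)],
      trivIset [set: 'I_m] (fun i => f i @` `[0, 1])
    & C = \bigcap_(n in [set: nat]) cantor_stage f n].

(* [diam set0] is [-oo]. *)
Definition diam (R : realType) (U : set R) : \bar R :=
  ereal_sup [set (`|x - y|%:E)%E | x in U & y in U].

(* [diam U] to the power [s]. The empty set contributes 0 even for [s = 0],
   while a nonempty set contributes 1 for [s = 0]. *)
Definition hausdorff_weight (R : realType) (s : R) (U : set R) : \bar R :=
  if `[< U = set0 >] then 0%E else (diam U `^ s)%E.

Definition hausdorff_premeasure (R : realType) (s d : R) (A : set R) :
    \bar R :=
  ereal_inf [set (\sum_(0 <= k <oo) hausdorff_weight s (U k))%E |
    U in [set U : nat -> set R |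
            A `<=` \bigcup_(k in [set: nat]) U k /\
            forall k, (diam (U k) <= d%:E)%E]].

Definition hausdorff_measure (R : realType) (s : R) (A : set R) : \bar R :=
  ereal_sup [set hausdorff_premeasure s d A | d in [set d : R | 0 < d]].

Definition hausdorff_dim (R : realType) (A : set R) : \bar R :=
  ereal_inf [set s%:E | s in [set s : R | 0 <= s /\ hausdorff_measure s A = 0%E]].

(* Main.v *)
Require Import Defs.
From HB Require Import structures.
From mathcomp Require Import all_boot all_order all_algebra.
From mathcomp Require Import all_classical all_reals all_analysis.
From mathcomp Require Import measurable_realfun ring lra.

(** Why the theorem holds.

    Let [F_w] be the composition of the maps along a word [w]. The points
    [F_w 0] approximate [C_l]. If two words split after a common prefix [u], the
    distance of their points is the product of one chord slope for each letter
    of [u] and of a distance bounded below by the gap between the images of the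
    maps. A chord slope is [c_i l] plus a divided difference of [g_i], which is
    Lipschitz in the parameter and in the end points with a constant of the order
    of the bound on the partial derivatives of [g_i]
    ([divided_difference_lipschitz]). If this bound is small, each slope decreases
    in absolute value at rate [delta / 2], while the last distance varies at
    bounded speed. Hence, for long [u], the absolute difference of the two points
    decreases at a speed at least proportional to the size of the cylinder of [u]
    ([word_map_transversal]), and the parameters for which the difference lies in
    a given interval of length [r] have measure [O(r / size)]. These are
    inequalities between the values at two parameters; the coding map is never
    differentiated. Words with a short common prefix are avoided by working
    inside one cylinder of high order.

    Fix [l0] inside [J] and [s < dim K], [t' < dim C_l0] with [1 < s + t']. Two
    families of weights are used. On [K], the content of [K] intersected with the
    half-line [x' <= x] is a nondecreasing function of [x], and it is
    [s]-Hoelder because the content is subadditive; its increments along a grid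
    play the role of a Frostman measure ([content_upto_holder]). On the words, a
    Bernoulli measure on blocks of [n] letters: since covers by cylinders are not
    cheap in the exponent [t'], the contraction ratios of the blocks satisfy
    [1 <= sum ratio `^ t'] ([sum_ratio_ge1]); for large [n] and for parameters
    close to [l0] the distortion of the blocks is negligible compared with their
    contraction ([block_ratio]), so the same holds for the lower ratios in a
    slightly smaller exponent.

    Sort the pairs of words by their common prefix ([tree_energy_le]) and
    integrate over the parameter. As [1 < s + t'], a geometric series bounds by
    [O(r)] the mean weight of the pairs of points of [K + C_l] at distance at most
    [2 r], uniformly in [r] ([total_energy_le]). By Fatou's lemma this weight is
    [O(r)] along a sequence [r -> 0] for almost every parameter near [l0]
    ([frequently_bounded_ae]); by Cauchy-Schwarz the [3 r]-neighborhoods of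
    [K + C_l] then have measure bounded below ([mass_energy]), and so has the
    compact set [K + C_l] ([neighborhood_measure_gt0]). Countably many intervals
    with rational ends cover [J] up to its end points. *)

Set Implicit Arguments.
Unset Strict Implicit.
Unset Printing Implicit Defensive.

Import Order.TTheory GRing.Theory Num.Theory.
Import numFieldNormedType.Exports.

Local Open Scope classical_set_scope.
Local Open Scope ring_scope.

(** * Derivatives relative to a set *)
Section CalculusWithin.
Context {R : realType}.
Implicit Types (D : set R) (f G : R -> R) (x t L : R).

Lemma slope_within_cvgP D f x L :
  diff_quotient f x @ within D x^' --> L <->
  (forall e, 0 < e -> exists2 d, 0 < d & forall y, D y -> y != x ->
    `|y - x| < d -> `|L - (f y - f x) / (y - x)| < e).
Proof.
split=> [/cvgrPdist_lt H e e0|H].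
  have /= := H e e0; rewrite !near_withinE => /nbhs_ballP[d /= d0 Hd].
  exists d => // y Dy yx yd; apply: Hd => //.
  by rewrite /ball/= distrC.
apply/cvgrPdist_lt => e e0.
have [d d0 Hd] := H e e0; rewrite !near_withinE; apply/nbhs_ballP; exists d => //= y.
by rewrite /ball/= distrC => yd yx Dy; exact: Hd.
Qed.

Lemma slope_within_continuous D f x L :
  diff_quotient f x @ within D x^' --> L ->
  f @ within D (nbhs x) --> f x.
Proof.
move=> df; apply/cvgrPdist_lt => e e0.
have [d d0 Hd] := (slope_within_cvgP D f x L).1 df 1 ltr01.
have L1 : 0 < `|L| + 1 by rewrite ltr_wpDl.
rewrite near_withinE; apply/nbhs_ballP.
exists (Num.min d (e / (`|L| + 1))) => /=.
  by rewrite lt_min d0 divr_gt0.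
move=> y; rewrite /ball/= lt_min distrC => /andP[yd ye] Dy.
have [->|yx] := eqVneq y x; first by rewrite subrr normr0.
have yx0 : y - x != 0 by rewrite subr_eq0.
have := Hd y Dy yx yd; set q := _ / _ => qL.
have -> : f x - f y = - (q * (y - x)) by rewrite /q divfK// opprB.
rewrite normrN normrM; move: ye; rewrite ltr_pdivlMr//; apply: le_lt_trans.
rewrite mulrC ler_wpM2l//.
have -> : q = L - (L - q) by ring.
by rewrite (le_trans (ler_normB _ _))// lerD2l ltW.
Qed.

Lemma slope_within_is_derive D f a b x L : `[a, b] `<=` D -> x \in `]a, b[ ->
  diff_quotient f x @ within D x^' --> L -> is_derive x 1 f L.
Proof.
move=> abD; rewrite in_itv/= => /andP[ax xb] df.
suff H : (fun h => h^-1 *: ((f \o shift x) (h *: 1) - f x)) @ 0^' --> L.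
  split; first by apply/cvg_ex; eexists; exact: H.
  by apply/cvg_lim => //; exact: norm_hausdorff.
apply/cvgrPdist_lt => e e0; have [d d0 Hd] := (slope_within_cvgP _ _ _ _).1 df e e0.
rewrite !near_withinE; apply/nbhs_ballP.
exists (Num.min d (Num.min (x - a) (b - x))) => /=.
  by rewrite !lt_min d0 !subr_gt0 ax.
move=> h; rewrite /ball/= sub0r normrN !lt_min => /and3P[hd h1 h2] h0.
have := Hd (h + x); rewrite addrK eq_sym -subr_eq0 opprD addrCA subrr addr0 oppr_eq0.
have -> : h *: (1 : R) = h by rewrite /GRing.scale/= mulr1.
rewrite /GRing.scale/= mulrC; apply=> //.
by apply: abD; rewrite /= in_itv/=; move: h1 h2; rewrite !ltr_norml => /andP[? ?] /andP[? ?]; lra.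
Qed.

(** The mean value theorem when derivatives are only taken relative to [D]:
    at an interior point of [[a, b]] they are ordinary derivatives. *)
Lemma MVT_slope_within D f (df : R -> R) a b : a < b -> `[a, b] `<=` D ->
  (forall x, D x -> diff_quotient f x @ within D x^' --> df x) ->
  exists2 c, a < c < b & f b - f a = df c * (b - a).
Proof.
move=> ab abD fdf; have [||c] := @MVT _ f df a b ab.
- move=> x xab; apply: (slope_within_is_derive abD xab (fdf _ _)).
  by apply: abD; exact: subset_itv_oo_cc.
- apply/subspace_continuousP => x xab.
  apply: cvg_trans (slope_within_continuous (fdf _ (abD _ xab))).
  by apply: cvg_app; apply: within_subset => //; exact: filter_filter'.
- by rewrite in_itv/= => ? ?; exists c.
Qed.

Lemma lipschitz_within D f a b E : `[a, b] `<=` D ->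
  (forall x, D x -> derivable_within D f x) ->
  (forall x, a <= x <= b -> `|derive_within D f x| <= E) ->
  forall x y, a <= x <= b -> a <= y <= b -> `|f x - f y| <= E * `|x - y|.
Proof.
move=> abD df dE x y; wlog xy : x y / x < y => [H|].
  have [/H//|yx|->] := ltgtP x y; last by rewrite !subrr normr0 mulr0.
  by move=> xab yab; rewrite distrC (distrC x); exact: H.
move=> /andP[ax xb] /andP[ay yb].
have xyD : `[x, y] `<=` D.
  move=> z/=; rewrite !in_itv/= => /andP[? ?]; apply: abD.
  by rewrite /= in_itv/=; apply/andP; split; lra.
have [c /andP[xc cy] e] := MVT_slope_within xy xyD df.
rewrite distrC (distrC x) e normrM ler_wpM2r// dE//.
by apply/andP; split; lra.
Qed.

(** The chain rule for an affine change of variable that sends the unit interval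
    into [D]. *)
Lemma slope_within_affine D G x l t L : l != 0 ->
  (forall u, `[0, 1]%classic u -> D (x + u * l)) ->
  diff_quotient G (x + t * l) @ within D (x + t * l)^' --> L ->
  diff_quotient (fun u => G (x + u * l) / l) t @ within `[0, 1] t^' --> L.
Proof.
move=> l0 HD /slope_within_cvgP H; apply/slope_within_cvgP => e e0.
have [d d0 Hd] := H e e0; exists (d / `|l|); first by rewrite divr_gt0// normr_gt0.
move=> y y01 yt ytd; have yt0 : y - t != 0 by rewrite subr_eq0.
have yl : x + y * l - (x + t * l) = (y - t) * l by ring.
have := Hd (x + y * l) (HD _ y01); rewrite -subr_eq0 yl mulf_neq0// normrM.
rewrite -ltr_pdivlMr ?normr_gt0// => /(_ isT ytd).
suff -> : (G (x + y * l) - G (x + t * l)) / ((y - t) * l) =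
  (G (x + y * l) / l - G (x + t * l) / l) / (y - t) by [].
by field; rewrite yt0.
Qed.

(** Divided differences of functions whose derivatives are close are close:
    on the unit interval reparametrized affinely, the difference of the two
    divided differences is the increment of one function, whose derivative is
    a difference of values of the derivatives. *)
Lemma divided_difference_lipschitz (G1 G2 : R -> R) E T :
  (forall x, `[0, 1]%classic x -> derivable_within `[0, 1] G1 x) ->
  (forall x, `[0, 1]%classic x -> derivable_within `[0, 1] G2 x) ->
  0 <= E ->
  (forall u v, 0 <= u <= 1 -> 0 <= v <= 1 ->
    `|derive_within `[0, 1] G1 u - derive_within `[0, 1] G2 v|
      <= E * (`|u - v| + T)) ->
  forall x x' y y', 0 <= x <= 1 -> 0 <= x' <= 1 -> 0 <= y <= 1 -> 0 <= y' <= 1 ->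
    x != x' -> y != y' ->
  `|(G1 x - G1 x') / (x - x') - (G2 y - G2 y') / (y - y')|
     <= E * (`|x - y| + `|x' - y'| + T).
Proof.
move=> d1 d2 E0 dE x x' y y' /andP[x0 x1] /andP[x'0 x'1] /andP[y0 y1] /andP[y'0 y'1].
rewrite -subr_eq0 => xx'; rewrite -subr_eq0 => yy'.
pose phi t := G1 (x' + t * (x - x')) / (x - x') - G2 (y' + t * (y - y')) / (y - y').
pose dphi t := derive_within `[0, 1] G1 (x' + t * (x - x'))
             - derive_within `[0, 1] G2 (y' + t * (y - y')).
have conv u v t : 0 <= u -> u <= 1 -> 0 <= v -> v <= 1 -> `[0, 1]%classic t ->
    `[0, 1]%classic (u + t * (v - u)).
  rewrite /= !in_itv/= => ? ? ? ? /andP[t0 t1].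
  have -> : u + t * (v - u) = (1 - t) * u + t * v by ring.
  apply/andP; split; first by rewrite addr_ge0// mulr_ge0// subr_ge0.
  rewrite -subr_ge0.
  have -> : 1 - ((1 - t) * u + t * v) = (1 - t) * (1 - u) + t * (1 - v) by ring.
  by rewrite addr_ge0// mulr_ge0// subr_ge0.
have [//|t t01|c /andP[c0 c1]] := @MVT_slope_within `[0, 1] phi dphi 0 1 ltr01.
  have -> : diff_quotient phi t =
    diff_quotient (fun u => G1 (x' + u * (x - x')) / (x - x')) t \-
    diff_quotient (fun u => G2 (y' + u * (y - y')) / (y - y')) t.
    by apply/funext => u/=; rewrite /diff_quotient /phi; ring.
  apply: cvgB; apply: (@slope_within_affine `[0, 1]) => //.
  + by move=> u u01; exact: conv.
  + by apply: d1; exact: conv.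
  + by move=> u u01; exact: conv.
  + by apply: d2; exact: conv.
have -> : phi 1 - phi 0 = (G1 x - G1 x') / (x - x') - (G2 y - G2 y') / (y - y').
  by rewrite /phi !mul1r !mul0r !addr0 !(addrC x') !(addrC y') !subrK; ring.
move=> ->; rewrite subr0 mulr1.
have c01 : `[0, 1]%classic c by rewrite /= in_itv/= !ltW.
have := conv x' x c x'0 x'1 x0 x1 c01; have := conv y' y c y'0 y'1 y0 y1 c01.
rewrite /= !in_itv/= => cy cx; apply: le_trans (dE _ _ cx cy) _.
rewrite ler_wpM2l// lerD2r.
have -> : x' + c * (x - x') - (y' + c * (y - y')) = c * (x - y) + (1 - c) * (x' - y') by ring.
rewrite (le_trans (ler_normD _ _))// !normrM lerD//.
  by rewrite (ger0_norm (ltW c0)) ler_piMl// ltW.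
by rewrite [X in X * _]ger0_norm ?subr_ge0 ?(ltW c1)// ler_piMl// gerBl ltW.
Qed.

End CalculusWithin.

(** * Families of maps whose chord slopes decrease with the parameter *)
Section ParametrizedMaps.
Context {R : realType}.
Variables (a b : R).
Implicit Types (f g : R -> R -> R).

(** [n] counts the letters of a composition. The points [x] and [x'] of [pm_cone]
    and [pm_decr] stand for the values at the parameters [l] and [m] of a point
    that moves at speed at most [Y]. [pm_decr] compares chord slopes
    at the two parameters in product form, so that degenerate chords obey it
    too. *)
Record parametrized_map (Y d : R) (n : nat) f : Prop := ParametrizedMap {
  pm_stable : forall l x, a <= l <= b -> 0 <= x <= 1 -> 0 <= f l x <= 1;
  pm_inj : forall l x y, a <= l <= b -> 0 <= x <= 1 -> 0 <= y <= 1 ->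
    f l x = f l y -> x = y;
  pm_cone : forall l m x y, a <= l <= b -> a <= m <= b ->
    0 <= x <= 1 -> 0 <= y <= 1 ->
    `|x - y| <= Y * `|l - m| -> `|f l x - f m y| <= Y * `|l - m|;
  pm_decr : forall l m x y x' y', a <= l <= b -> a <= m <= b -> l <= m ->
    0 <= x <= 1 -> 0 <= y <= 1 -> 0 <= x' <= 1 -> 0 <= y' <= 1 ->
    `|x - x'| <= Y * `|l - m| -> `|y - y'| <= Y * `|l - m| ->
    `|f m x' - f m y'| * `|x - y| <=
      (1 - d * (m - l)) ^+ n * (`|f l x - f l y| * `|x' - y'|) }.

Definition ratio_between (lo hi : R) f :=
  forall l x y, a <= l <= b -> 0 <= x <= 1 -> 0 <= y <= 1 ->
    lo * `|x - y| <= `|f l x - f l y| <= hi * `|x - y|.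

(** Comparison of chord slopes, again in product form: [N] weighs the distance of
    the parameters and [S] the distances of the end points. *)
Definition distortion_le (Q N S : R) f :=
  forall l m x y x' y', a <= l <= b -> a <= m <= b ->
    0 <= x <= 1 -> 0 <= y <= 1 -> 0 <= x' <= 1 -> 0 <= y' <= 1 ->
    `|f l x - f l y| * `|x' - y'| <=
      expR (Q * (N * `|l - m| + S * (`|x - x'| + `|y - y'|))) *
        (`|f m x' - f m y'| * `|x - y|).

Lemma parametrized_map_id Y d : parametrized_map Y d 0 (fun _ x => x).
Proof.
by split=> // *; rewrite expr0 mul1r mulrC.
Qed.

(** The slope of a chord of [f \o g] is the slope of a chord of [f] between moving
    points times the slope of a chord of [g]; injectivity of [g] lets the common
    distance cancel. *)
Lemma parametrized_map_comp Y d n n' f g : d * (b - a) <= 1 -> 0 <= d ->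
  parametrized_map Y d n f -> parametrized_map Y d n' g ->
  parametrized_map Y d (n + n') (fun l x => f l (g l x)).
Proof.
move=> dba d0 [fs fi fc fd] [gs gi gc gd]; split=> //.
- by move=> l x ? ?; apply: fs => //; exact: gs.
- by move=> l x y lab x01 y01 /fi e; apply: (gi l) => //; apply: e => //; exact: gs.
- move=> l m x y lab mab x01 y01 xy; apply: fc => //; [exact: gs|exact: gs|].
  exact: gc.
- move=> l m x y x' y' lab mab lm x01 y01 x'01 y'01 xx' yy'.
  set t := 1 - _.
  have t0 : 0 <= t.
    rewrite /t subr_ge0 (le_trans _ dba)// ler_wpM2l//.
    by move: lab mab => /andP[? ?] /andP[? ?]; lra.
  have [gxy|gxy] := eqVneq (g l x) (g l y).
    by rewrite (gi l _ _ lab x01 y01 gxy) !subrr normr0 mulr0 mul0r mulr0.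
  have gn : 0 < `|g l x - g l y| by rewrite normr_gt0 subr_eq0.
  rewrite -(ler_pM2r gn) mulrAC.
  have := fd l m (g l x) (g l y) (g m x') (g m y') lab mab lm (gs _ _ lab x01)
    (gs _ _ lab y01) (gs _ _ mab x'01) (gs _ _ mab y'01)
    (gc _ _ _ _ lab mab x01 x'01 xx') (gc _ _ _ _ lab mab y01 y'01 yy').
  move=> /(ler_wpM2r (normr_ge0 (x - y))) /le_trans; apply; rewrite -/t.
  have := gd l m x y x' y' lab mab lm x01 y01 x'01 y'01 xx' yy'.
  have B0 : 0 <= t ^+ n * `|f l (g l x) - f l (g l y)|.
    by rewrite mulr_ge0// exprn_ge0.
  move=> /(ler_wpM2l B0); rewrite -/t exprD => H.
  by rewrite -!mulrA in H *; rewrite [leRHS](_ : _ =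
    t ^+ n * (`|f l (g l x) - f l (g l y)| *
     (t ^+ n' * (`|g l x - g l y| * `|x' - y'|))))//; ring.
Qed.

Lemma parametrized_map_weaken Y d n n' f : d * (b - a) <= 1 -> 0 <= d ->
  (n' <= n)%N -> parametrized_map Y d n f -> parametrized_map Y d n' f.
Proof.
move=> dba d0 nn' [fs fi fc fd]; split=> //.
move=> l m x y x' y' lab mab lm *; apply: le_trans (fd l m x y x' y' _ _ _ _ _ _ _ _ _) _ => //.
have t0 : 0 <= d * (m - l) by rewrite mulr_ge0// subr_ge0.
rewrite ler_wpM2r ?mulr_ge0//; apply: ler_wiXn2l => //; last by lra.
rewrite subr_ge0 (le_trans _ dba)// ler_wpM2l//.
by move: lab mab => /andP[? ?] /andP[? ?]; lra.
Qed.

Lemma ratio_between_comp lo hi lo' hi' f g : 0 <= lo -> 0 <= hi ->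
  (forall l x, a <= l <= b -> 0 <= x <= 1 -> 0 <= g l x <= 1) ->
  ratio_between lo hi f -> ratio_between lo' hi' g ->
  ratio_between (lo * lo') (hi * hi') (fun l x => f l (g l x)).
Proof.
move=> lo0 hi0 gs ff gg l x y lab x01 y01.
have /andP[f1 f2] := ff l _ _ lab (gs _ _ lab x01) (gs _ _ lab y01).
have /andP[g1 g2] := gg l _ _ lab x01 y01.
rewrite -!mulrA; apply/andP; split.
  by apply: le_trans f1; rewrite ler_wpM2l.
by apply: (le_trans f2); rewrite ler_wpM2l.
Qed.

(** The outer map sees end points that [g] has brought together by the factor
    [th] and moved at speed at most [Y]; hence the increments of [N] and [S]. *)
Lemma distortion_le_comp Y d n n' Q N S th f g : 0 <= Q -> 0 <= Y ->
  parametrized_map Y d n f -> distortion_le Q 1 1 f ->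
  parametrized_map Y d n' g -> distortion_le Q N S g ->
  ratio_between 0 th g ->
  distortion_le Q (N + (1 + 2 * Y)) (S + th) (fun l x => f l (g l x)).
Proof.
move=> Q0 Y0 fp fd gp gd gr l m x y x' y' lab mab x01 y01 x'01 y'01.
have [gs gi gc _] := gp.
have YT0 : 0 <= Y * `|l - m| by rewrite mulr_ge0.
have step u u' : 0 <= u <= 1 -> 0 <= u' <= 1 ->
    `|g l u - g m u'| <= th * `|u - u'| + Y * `|l - m|.
  move=> u01 u'01; have /andP[_ h1] := gr l u u' lab u01 u'01.
  have := gc l m u' u' lab mab u'01 u'01; rewrite subrr normr0 => /(_ YT0) h2.
  have -> : g l u - g m u' = (g l u - g l u') + (g l u' - g m u') by ring.
  by rewrite (le_trans (ler_normD _ _))// lerD.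
have [gxy|gxy] := eqVneq (g m x') (g m y').
  by rewrite (gi m _ _ mab x'01 y'01 gxy) !subrr normr0 mulr0 mul0r mulr0.
have gn : 0 < `|g m x' - g m y'| by rewrite normr_gt0 subr_eq0.
rewrite -(ler_pM2r gn) mulrAC.
have := fd l m (g l x) (g l y) (g m x') (g m y') lab mab
  (gs _ _ lab x01) (gs _ _ lab y01) (gs _ _ mab x'01) (gs _ _ mab y'01).
move=> /(ler_wpM2r (normr_ge0 (x' - y'))) /le_trans; apply.
set e1 := expR _; set B := `|f m _ - _|.
have := gd l m x y x' y' lab mab x01 y01 x'01 y'01; set e2 := expR _ => H2.
have e10 : 0 <= e1 by exact: expR_ge0.
have B0 : 0 <= B by exact: normr_ge0.
have e12 : e1 * e2 <= expR (Q * ((N + (1 + 2 * Y)) * `|l - m| +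
    (S + th) * (`|x - x'| + `|y - y'|))).
  rewrite -expRD ler_expR -mulrDr ler_wpM2l//.
  by have := step _ _ x01 x'01; have := step _ _ y01 y'01; lra.
apply: (@le_trans _ _ (e1 * B * (e2 * (`|g m x' - g m y'| * `|x - y|)))).
  have -> : e1 * (B * `|g l x - g l y|) * `|x' - y'| =
    e1 * B * (`|g l x - g l y| * `|x' - y'|) by ring.
  by rewrite ler_wpM2l// mulr_ge0.
rewrite (_ : _ * _ = e1 * e2 * (B * `|x - y| * `|g m x' - g m y'|)); last by ring.
by rewrite -[leRHS]mulrA ler_wpM2r// !mulr_ge0.
Qed.

End ParametrizedMaps.

(** The slope of a chord of a nearly affine map is [c l] plus a divided
    difference of the perturbation [g]; the latter varies with the parameter
    and the end points at a rate small compared with [de], so that the decrease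
    of [|c|] wins as long as the end points move at speed at most [Y]. *)
Section NearlyAffine.
Context {R : realType}.
Variables (a b A E ka de Y sg : R) (c s : R -> R) (g : R * R -> R).
Let f l x := c l * x + s l + g (x, l).

Hypothesis ka0 : 0 < ka.
Hypothesis de0 : 0 < de.
Hypothesis A0 : 0 <= A.
Hypothesis E0 : 0 <= E.
Hypothesis Eka : E <= ka / 2.
Hypothesis EY : E * (2 * Y + 1) <= de / 2.
Hypothesis AY : 2 * A + E <= Y * (ka / 2).
Hypothesis sg1 : sg ^+ 2 = 1.
Hypothesis c_sign : forall l, a <= l <= b -> ka <= sg * c l <= 1 - ka.
Hypothesis c_decr : forall l m, a <= l <= b -> a <= m <= b -> l <= m ->
  sg * c m <= sg * c l - de * (m - l).
Hypothesis c_lip : forall l m, a <= l <= b -> a <= m <= b ->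
  `|c l - c m| <= A * `|l - m|.
Hypothesis s_lip : forall l m, a <= l <= b -> a <= m <= b ->
  `|s l - s m| <= A * `|l - m|.
Hypothesis g_lip : forall (x l m : R), 0 <= x <= 1 -> a <= l <= b -> a <= m <= b ->
  `|g (x, l) - g (x, m)| <= E * `|l - m|.
Hypothesis g_der : forall l, a <= l <= b -> forall x : R, `[0, 1]%classic x ->
  derivable_within `[0, 1] (fun x => g (x, l)) x.
Hypothesis g_der_le : forall (x l : R), 0 <= x <= 1 -> a <= l <= b ->
  `|partial1 `[0, 1] g (x, l)| <= E.
Hypothesis g_der_lip : forall (x y l m : R), 0 <= x <= 1 -> 0 <= y <= 1 ->
  a <= l <= b -> a <= m <= b ->
  `|partial1 `[0, 1] g (x, l) - partial1 `[0, 1] g (y, m)|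
     <= E * (`|x - y| + `|l - m|).
Hypothesis f_stable : forall (l x : R), a <= l <= b -> 0 <= x <= 1 -> 0 <= f l x <= 1.

Let slope l x y := c l + (g (x, l) - g (y, l)) / (x - y).

Let f_slope l x y : x != y -> f l x - f l y = slope l x y * (x - y).
Proof.
rewrite -subr_eq0 => xy; rewrite /slope mulrDl divfK// /f; ring.
Qed.

Let norm_sg x : `|x| = `|sg * x|.
Proof.
have : `|sg| ^+ 2 = 1 by rewrite -normrX sg1 normr1.
rewrite normrM => /eqP; rewrite sqrf_eq1 => /orP[/eqP->|/eqP e]; first by rewrite mul1r.
by have := normr_ge0 sg; rewrite e; lra.
Qed.

Let g_slope_le l x y : a <= l <= b -> 0 <= x <= 1 -> 0 <= y <= 1 ->
  `|g (x, l) - g (y, l)| <= E * `|x - y|.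
Proof.
move=> lab; apply: (@lipschitz_within _ `[0, 1] (fun x => g (x, l))) => //.
  exact: g_der.
by move=> z z01; exact: g_der_le.
Qed.

Let g_quot_le l x y : a <= l <= b -> 0 <= x <= 1 -> 0 <= y <= 1 ->
  x != y -> `|sg * ((g (x, l) - g (y, l)) / (x - y))| <= ka / 2.
Proof.
move=> lab x01 y01 xy; rewrite -norm_sg normrM normfV ler_pdivrMr ?normr_gt0 ?subr_eq0//.
by apply: le_trans (g_slope_le lab x01 y01) _; rewrite ler_wpM2r.
Qed.

Let slope_bounds l x y : a <= l <= b -> 0 <= x <= 1 -> 0 <= y <= 1 ->
  x != y -> ka / 2 <= sg * slope l x y <= 1 - ka / 2.
Proof.
move=> lab x01 y01 xy; have := g_quot_le lab x01 y01 xy.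
rewrite ler_norml /slope mulrDr => /andP[? ?]; have /andP[? ?] := c_sign lab.
by apply/andP; split; lra.
Qed.

Let norm_slope l x y : a <= l <= b -> 0 <= x <= 1 -> 0 <= y <= 1 ->
  x != y -> `|slope l x y| = sg * slope l x y.
Proof.
move=> lab x01 y01 xy; rewrite norm_sg ger0_norm//.
have /andP[+ _] := slope_bounds lab x01 y01 xy; apply: le_trans.
by rewrite divr_ge0// ltW.
Qed.

Let g_quot_lip l m x y x' y' : a <= l <= b -> a <= m <= b ->
  0 <= x <= 1 -> 0 <= y <= 1 -> 0 <= x' <= 1 -> 0 <= y' <= 1 ->
  x != y -> x' != y' ->
  `|sg * ((g (x, l) - g (y, l)) / (x - y))
      - sg * ((g (x', m) - g (y', m)) / (x' - y'))|
   <= E * (`|x - x'| + `|y - y'| + `|l - m|).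
Proof.
move=> lab mab x01 y01 x'01 y'01 xy x'y'; rewrite -mulrBr -norm_sg.
apply: (@divided_difference_lipschitz _ (fun x => g (x, l)) (fun x => g (x, m)));
  rewrite //; try exact: g_der.
by move=> u v u01 v01; exact: g_der_lip.
Qed.

Lemma nearly_affine_ratio : ratio_between a b (ka / 2) (1 - ka / 2) f.
Proof.
move=> l x y lab x01 y01; have [->|xy] := eqVneq x y.
  by rewrite !subrr normr0 !mulr0 lexx.
rewrite f_slope// normrM norm_slope//.
by have /andP[? ?] := slope_bounds lab x01 y01 xy; rewrite !ler_wpM2r.
Qed.

Lemma nearly_affine_parametrized_map : parametrized_map a b Y (de / 2) 1 f.
Proof.
have ka20 : 0 < ka / 2 by rewrite divr_gt0.
split=> //.
- move=> l x y lab x01 y01 e; apply/eqP; rewrite -subr_eq0 -normr_le0.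
  have /andP[+ _] := nearly_affine_ratio lab x01 y01.
  by rewrite e subrr normr0 pmulr_rle0.
- move=> l m x y lab mab x01 y01 xy.
  have /andP[_ h1] := nearly_affine_ratio lab x01 y01.
  have -> : f l x - f m y = (f l x - f l y) + ((c l - c m) * y +
    (s l - s m) + (g (y, l) - g (y, m))) by rewrite /f; ring.
  rewrite (le_trans (ler_normD _ _))//.
  have h2 := c_lip lab mab; have h3 := s_lip lab mab; have h4 := g_lip y01 lab mab.
  have h5 : `|(c l - c m) * y| <= A * `|l - m|.
    move: y01 => /andP[y0 y1]; rewrite normrM (ger0_norm y0).
    by apply: le_trans h2; rewrite ler_piMr.
  (* [AY] says that a point contracted by [1 - ka / 2] and then moved at the speed
     of the map itself still moves at speed at most [Y]. *)
  have h6 : `|f l x - f l y| <= (1 - ka / 2) * (Y * `|l - m|).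
    by apply: (le_trans h1); rewrite ler_wpM2l// (le_trans _ (_ : 1/2 <= _))//;
      have /andP[? ?] := c_sign lab; lra.
  have h7 := ler_wpM2r (normr_ge0 (l - m)) AY.
  have h8 := ler_normD ((c l - c m) * y + (s l - s m)) (g (y, l) - g (y, m)).
  have h9 := ler_normD ((c l - c m) * y) (s l - s m).
  lra.
- move=> l m x y x' y' lab mab lm x01 y01 x'01 y'01 xx' yy'; rewrite expr1.
  have [->|xy] := eqVneq x y; first by rewrite !subrr normr0 mul0r !mulr0.
  have [->|x'y'] := eqVneq x' y'; first by rewrite !subrr normr0 mul0r !mulr0.
  rewrite !f_slope// !normrM !norm_slope//.
  have H : sg * slope m x' y' <= (1 - de / 2 * (m - l)) * (sg * slope l x y).
    have := g_quot_lip lab mab x01 y01 x'01 y'01 xy x'y'.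
    have := slope_bounds lab x01 y01 xy.
    have := c_decr lab mab lm.
    rewrite /slope !mulrDr (distrC l m) (ger0_norm (_ : 0 <= m - l)) ?subr_ge0//.
    rewrite (distrC l m) (ger0_norm (_ : 0 <= m - l)) ?subr_ge0// in xx' yy'.
    set G1 := sg * (_ / (x - y)); set G2 := sg * (_ / _).
    move=> h1 /andP[h2 h3]; rewrite ler_distl => /andP[h4 h5].
    have t0 : 0 <= m - l by rewrite subr_ge0.
    have h6 : E * (`|x - x'| + `|y - y'| + (m - l)) <= de / 2 * (m - l).
      apply: le_trans (ler_wpM2r t0 EY); rewrite -mulrA ler_wpM2l//; lra.
    have h7 : de / 2 * (m - l) * (sg * c l + G1) <= de / 2 * (m - l).
      by rewrite ler_piMr//; [rewrite mulr_ge0// divr_ge0// ltW|lra].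
    lra.
  rewrite [leLHS](_ : _ = sg * slope m x' y' * (`|x' - y'| * `|x - y|)); last by ring.
  rewrite [leRHS](_ : _ = (1 - de / 2 * (m - l)) * (sg * slope l x y) *
    (`|x' - y'| * `|x - y|)); last by ring.
  by rewrite ler_wpM2r// mulr_ge0.
Qed.

Lemma nearly_affine_distortion :
  distortion_le a b ((A + E) / (ka / 2)) 1 1 f.
Proof.
have ka20 : 0 < ka / 2 by rewrite divr_gt0.
move=> l m x y x' y' lab mab x01 y01 x'01 y'01.
have [->|xy] := eqVneq x y; first by rewrite !subrr normr0 mul0r !mulr0.
have [->|x'y'] := eqVneq x' y'; first by rewrite !subrr normr0 mul0r !mulr0.
rewrite !f_slope// !normrM !norm_slope// !mul1r.
set D := _ + (_ + _).
have H : sg * slope l x y <= expR ((A + E) / (ka / 2) * D) * (sg * slope m x' y').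
  apply: (@le_trans _ _ ((1 + (A + E) / (ka / 2) * D) * (sg * slope m x' y'))).
    have := g_quot_lip lab mab x01 y01 x'01 y'01 xy x'y'.
    have := slope_bounds mab x'01 y'01 x'y'.
    have h0 : sg * c l - sg * c m <= A * `|l - m|.
      rewrite -mulrBr (le_trans (ler_norm _))// -norm_sg; exact: c_lip.
    rewrite /slope ![sg * (c _ + _)]mulrDr.
    set G1 := sg * (_ / (x - y)); set G2 := sg * (_ / _).
    move=> /andP[h2 h3]; rewrite ler_distl => /andP[h4 h5].
    have D0 : 0 <= D by rewrite !addr_ge0.
    have h6 : E * (`|x - x'| + `|y - y'| + `|l - m|) <= E * D.
      by rewrite ler_wpM2l// /D; lra.
    have h7 : A * `|l - m| <= A * D.
      by rewrite ler_wpM2l// /D lerDl addr_ge0.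
    have h8 : (A + E) * D <= (A + E) / (ka / 2) * D * (sg * c m + G2).
      rewrite mulrAC ler_wpM2r// -[leLHS]mulr1 -[leRHS]mulrA ler_wpM2l ?addr_ge0//.
      by rewrite mulrC ler_pdivlMr// mul1r.
    rewrite mulrDl mul1r; move: h8; set u := _ * D * _ => h8.
    lra.
  rewrite ler_wpM2r ?expR_ge1Dx//.
  by have /andP[+ _] := slope_bounds mab x'01 y'01 x'y'; apply: le_trans; exact: ltW.
rewrite [leLHS](_ : _ = sg * slope l x y * (`|x' - y'| * `|x - y|)); last by ring.
rewrite [leRHS](_ : _ = expR ((A + E) / (ka / 2) * D) * (sg * slope m x' y') *
    (`|x' - y'| * `|x - y|)); last by ring.
by rewrite ler_wpM2r// mulr_ge0.
Qed.

End NearlyAffine.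

(** * Compositions along words and transversality *)
Section Words.
Context {R : realType} {W : eqType}.
Variables (a b Y d : R) (F : W -> R -> R -> R).

Definition word_map (w : seq W) (l x : R) : R := foldr (fun i => F i l) x w.

Lemma word_map_cat u v l x : word_map (u ++ v) l x = word_map u l (word_map v l x).
Proof. exact: foldr_cat. Qed.

Hypothesis dba : d * (b - a) <= 1.
Hypothesis d0 : 0 <= d.
Hypothesis F_pm : forall i, parametrized_map a b Y d 1 (F i).

Lemma word_map_pm w : parametrized_map a b Y d (size w) (word_map w).
Proof.
elim: w => [|i w IH] /=; first exact: parametrized_map_id.
exact: (parametrized_map_comp dba d0 (F_pm i) IH).
Qed.

Lemma word_map_ratio (lo hi : W -> R) w :
  (forall i, 0 <= lo i) -> (forall i, 0 <= hi i) ->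
  (forall i, ratio_between a b (lo i) (hi i) (F i)) ->
  ratio_between a b (\prod_(i <- w) lo i) (\prod_(i <- w) hi i) (word_map w).
Proof.
move=> lo0 hi0 F_ratio; elim: w => [|i w IH].
  by move=> l x y _ _ _; rewrite !big_nil !mul1r lexx.
rewrite !big_cons; apply: ratio_between_comp => //.
exact: (pm_stable (word_map_pm w)).
Qed.

Lemma word_map_lip w l m : 0 <= Y -> a <= l <= b -> a <= m <= b ->
  `|word_map w l 0 - word_map w m 0| <= Y * `|l - m|.
Proof.
move=> Y0 lab mab; apply: (pm_cone (word_map_pm w)); rewrite ?lexx ?ler01//.
by rewrite subrr normr0 mulr_ge0.
Qed.

(** Past their common prefix the two words start in disjoint cylinders; each
    letter of the prefix costs a factor [lo]. *)
Lemma word_map_gap gap (lo : R) u v l x y : 0 <= lo <= 1 -> 0 <= gap ->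
  (forall i l x y, a <= l <= b -> 0 <= x <= 1 -> 0 <= y <= 1 ->
     lo * `|x - y| <= `|F i l x - F i l y|) ->
  (forall i j l x y, i != j -> a <= l <= b -> 0 <= x <= 1 -> 0 <= y <= 1 ->
     gap <= `|F i l x - F j l y|) ->
  size u = size v -> u != v ->
  a <= l <= b -> 0 <= x <= 1 -> 0 <= y <= 1 ->
  lo ^+ (size u) * gap <= `|word_map u l x - word_map v l y|.
Proof.
move=> /andP[lo0 lo1] gap0 Flo Fgap + + lab x01 y01.
elim: u v => [|i u IH] [|j v]// [] suv.
have st w z := pm_stable (word_map_pm w) lab (x := z).
have [<-|ij _ /=] := eqVneq i j; last first.
  apply: le_trans (Fgap i j l _ _ ij lab (st u x x01) (st v y y01)).
  by rewrite ler_piMl// exprn_ile1.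
rewrite eqseq_cons eqxx/= => uv.
apply: le_trans (Flo i l _ _ lab (st u x x01) (st v y y01)).
by rewrite exprS -mulrA ler_wpM2l// IH.
Qed.

(** The distance between two points of different cylinders inside the cylinder
    of a long word [u] is the product of one slope per letter of [u], each
    decreasing at rate [d], and of a distance at least [gap] varying at speed at
    most [2 Y]. The first effect wins when [u] is long. *)
Lemma word_map_transversal gap (L : R) u i j v v' l m :
  0 <= Y -> 0 < gap -> b - a <= 1 ->
  1 + 2 * Y / gap <= d * (size u)%:R ->
  (forall i j l x y, i != j -> a <= l <= b -> 0 <= x <= 1 -> 0 <= y <= 1 ->
     gap <= `|F i l x - F j l y|) ->
  0 <= L -> (forall l x y, a <= l <= b -> 0 <= x <= 1 -> 0 <= y <= 1 ->
     L * `|x - y| <= `|word_map u l x - word_map u l y|) ->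
  i != j -> a <= l <= b -> a <= m <= b ->
  gap * L / 2 * `|l - m| <=
  `|(word_map (u ++ i :: v) l 0 - word_map (u ++ j :: v') l 0) -
    (word_map (u ++ i :: v) m 0 - word_map (u ++ j :: v') m 0)|.
Proof.
move=> Y0 gap0 ba1 un Fgap L0 Lu ij.
wlog lm : l m / l <= m => [H lab mab|lab mab].
  have [/H//|/ltW ml] := leP l m; first exact.
  by rewrite distrC [leRHS]distrC; exact: H.
have z01 : 0 <= (0 : R) <= 1 by rewrite lexx ler01.
rewrite !word_map_cat.
set p := word_map (i :: v); set q := word_map (j :: v').
set hl := word_map u l _ - _; set hm := word_map u m _ - _.
have st w := pm_stable (word_map_pm w).
have Dl : gap <= `|p l 0 - q l 0| by apply: Fgap => //; exact: st.
set t := m - l.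
have t0 : 0 <= t by rewrite subr_ge0.
have t1 : t <= 1 by move: lab mab => /andP[? ?] /andP[? ?]; rewrite /t; lra.
have nt : `|l - m| = t by rewrite distrC ger0_norm.
have pl : `|p l 0 - p m 0| <= Y * t by rewrite -nt; exact: word_map_lip.
have ql : `|q l 0 - q m 0| <= Y * t by rewrite -nt; exact: word_map_lip.
have Dm : `|p m 0 - q m 0| <= `|p l 0 - q l 0| * (1 + 2 * Y / gap * t).
  have -> : p m 0 - q m 0 = (p l 0 - q l 0) - ((p l 0 - p m 0) - (q l 0 - q m 0)).
    by ring.
  apply: le_trans (ler_normB _ _) _; rewrite mulrDr mulr1 lerD2l.
  apply: le_trans (ler_normB _ _) _.
  apply: (@le_trans _ _ (gap * (2 * Y / gap * t))).
    by rewrite mulrA mulrC (mulrC gap) divfK ?gt_eqF// mulrC; lra.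
  by rewrite ler_wpM2r// mulr_ge0// divr_ge0 ?mulr_ge0// ltW.
have Hd : `|hm| * `|p l 0 - q l 0| <=
    (1 - d * t) ^+ size u * (`|hl| * `|p m 0 - q m 0|).
  apply: (pm_decr (word_map_pm u)) => //; rewrite ?nt//; exact: st.
have D0 : 0 < `|p l 0 - q l 0| by exact: lt_le_trans Dl.
have dt0 : 0 <= 1 - d * t.
  rewrite subr_ge0 (le_trans _ dba)// ler_wpM2l//.
  by move: lab mab => /andP[? ?] /andP[? ?]; rewrite /t; lra.
have Q0 : 0 <= 2 * Y / gap by rewrite divr_ge0 ?mulr_ge0// ltW.
(* [d * size u] exceeds the logarithmic speed [2 * Y / gap] of the last factor by
   at least one, and [expR (- t) <= 1 - t / 2] on the unit interval. *)
have key : (1 - d * t) ^+ size u * (1 + 2 * Y / gap * t) <= 1 - t / 2.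
  have h1 : (1 - d * t) ^+ size u <= expR (- (d * t) *+ size u).
    rewrite -mulr_natl expRM_natl lerXn2r ?nnegrE ?expR_ge0//.
    exact: expR_ge1Dx.
  have h2 := expR_ge1Dx (2 * Y / gap * t).
  have h3 : 0 <= 1 + 2 * Y / gap * t by rewrite addr_ge0// mulr_ge0.
  apply: (le_trans (ler_pM (exprn_ge0 _ dt0) h3 h1 h2)).
  rewrite -expRD; apply: (@le_trans _ _ (expR (- t))).
    rewrite ler_expR -mulr_natr.
    by have := ler_wpM2r t0 un; lra.
  rewrite expRN -[leLHS]mulr1 mulrC ler_pdivrMr ?expR_gt0//.
  apply: (@le_trans _ _ ((1 - t / 2) * (1 + t))).
    by have := ler_wpM2l t0 t1; lra.
  by rewrite ler_wpM2l ?expR_ge1Dx//; lra.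
have hml : `|hm| <= (1 - t / 2) * `|hl|.
  rewrite -(ler_pM2r D0); apply: (le_trans Hd).
  apply: le_trans (_ : (1 - d * t) ^+ size u * (`|hl| * (`|p l 0 - q l 0| * (1 + 2 * Y / gap * t))) <= _).
    by rewrite ler_wpM2l ?exprn_ge0// ler_wpM2l.
  rewrite [leLHS](_ : _ = (1 - d * t) ^+ size u * (1 + 2 * Y / gap * t) *
    (`|hl| * `|p l 0 - q l 0|)); last by ring.
  by rewrite -[leRHS]mulrA ler_wpM2r// mulr_ge0.
have hlL : gap * L <= `|hl|.
  apply: le_trans (Lu l _ _ lab (st _ _ _ lab z01) (st _ _ _ lab z01)).
  by rewrite mulrC ler_wpM2l.
rewrite nt; apply: le_trans (ler_dist_dist _ _); rewrite -[leRHS]ger0_norm//.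
apply: le_trans (ler_norm _); apply: le_trans (ler_norm _).
have := ler_wpM2r t0 hlL; lra.
Qed.

End Words.

Section Sublevel.
Context {R : realType}.
Variables (a b : R).
Implicit Types (h : R -> R) (r K : R).

Definition sublevel h r : set R := [set l | a <= l <= b /\ `|h l| <= r].

Lemma sublevel_measurable h r K : 0 <= K ->
  (forall l m, a <= l <= b -> a <= m <= b -> `|h l - h m| <= K * `|l - m|) ->
  measurable (sublevel h r).
Proof.
move=> K0 hK.
have -> : sublevel h r = `[a, b] `&` h @^-1` `[-r, r].
  by apply/seteqP; split => l; rewrite /sublevel /= !in_itv/= ler_norml.
have mh : measurable_fun `[a, b] h.
  apply: subspace_continuous_measurable_fun => //.
  apply/subspace_continuousP => x xab; apply/cvgrPdist_lt => e e0.
  rewrite near_withinE; apply/nbhs_ballP; exists (e / (K + 1)) => /=.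
    by rewrite divr_gt0// ltr_wpDl.
  move=> y; rewrite /ball/= ltr_pdivlMr ?ltr_wpDl// => xy yab.
  move: xab yab; rewrite /= !in_itv/= => xab yab.
  apply: le_lt_trans (hK _ _ xab yab) _; apply: le_lt_trans xy.
  by rewrite mulrC ler_wpM2l// lerDl.
by apply: mh => //; exact: measurable_itv.
Qed.

Lemma sublevel_le h r : (lebesgue_measure (sublevel h r) <= `|b - a|%:E)%E.
Proof.
apply: (@le_trans _ _ (lebesgue_measure `[a, b])).
  by apply: le_outer_measure => l /= []; rewrite in_itv.
rewrite lebesgue_measure_itv/=; case: ifPn => _; last by rewrite lee_fin.
by rewrite -EFinB lee_fin ler_norm.
Qed.

(** Any two points of the sublevel set are at distance at most [2 * r / K]. *)
Lemma sublevel_le_transversal h r K : 0 < K -> 0 <= r ->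
  (forall l m, a <= l <= b -> a <= m <= b -> K * `|l - m| <= `|h l - h m|) ->
  (lebesgue_measure (sublevel h r) <= (4 * r / K)%:E)%E.
Proof.
move=> K0 r0 hK.
have r0K : 0 <= 2 * r / K by rewrite divr_ge0 ?mulr_ge0// ltW.
have [->|/set0P[l0 [l0ab hl0]]] := eqVneq (sublevel h r) set0.
  by rewrite measure0 lee_fin; lra.
apply: (@le_trans _ _ (lebesgue_measure `[l0 - 2 * r / K, l0 + 2 * r / K])).
  apply: le_outer_measure => l /= [lab hl]; rewrite in_itv/= -ler_distl.
  rewrite ler_pdivlMr// mulrC; apply: le_trans (hK _ _ lab l0ab) _.
  by apply: le_trans (ler_normB _ _) _; lra.
rewrite lebesgue_measure_itv/=; case: ifPn => _; last by rewrite lee_fin; lra.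
by rewrite -EFinB lee_fin; lra.
Qed.

End Sublevel.

(** * Covers by intervals and Hausdorff dimension *)
Section Content.
Context {R : realType}.
Implicit Types (A K : set R) (l : seq (R * R)) (s : R).

Definition interval_cover A l :=
  (forall p, p \in l -> p.1 <= p.2) /\
  (forall x, A x -> exists2 p, p \in l & p.1 <= x <= p.2).

Definition cover_cost s l : R := \sum_(p <- l) (p.2 - p.1) `^ s.

Lemma cover_cost_ge0 s l : 0 <= cover_cost s l.
Proof. by apply: sumr_ge0 => p _; exact: powR_ge0. Qed.

Lemma hausdorff_premeasure_le_cost s d A l : 0 < s -> interval_cover A l ->
  (forall p, p \in l -> p.2 - p.1 <= d) ->
  (hausdorff_premeasure s d A <= (cover_cost s l)%:E)%E.
Proof.
move=> s0 [lle lA] ld.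
pose U k : set R := if (k < size l)%N then
  `[(nth (0, 0) l k).1, (nth (0, 0) l k).2]%classic else set0.
have diamU k : (k < size l)%N ->
    (diam (U k) <= ((nth (0, 0) l k).2 - (nth (0, 0) l k).1)%:E)%E.
  move=> kl; apply: ge_ereal_sup => _ [x + [y + <-]].
  rewrite /U kl /= !in_itv/= lee_fin => /andP[? ?] /andP[? ?].
  by rewrite ler_norml; apply/andP; split; lra.
have w0 V : (0 <= hausdorff_weight s V)%E.
  by rewrite /hausdorff_weight; case: ifP => // _; exact: poweR_ge0.
apply: (@le_trans _ _ (\sum_(0 <= k <oo) hausdorff_weight s (U k))%E).
  apply: ereal_inf_lbound; exists U => //; split.
    move=> x /lA[p pl xp]; exists (index p l) => //.
    by rewrite /U index_mem pl nth_index//= in_itv.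
  move=> k; have [kl|kl] := ltnP k (size l).
    by apply: (le_trans (diamU k kl)); rewrite lee_fin ld// mem_nth.
  rewrite /U ltnNge kl/= /diam; apply: ge_ereal_sup => _ [x []].
rewrite (nneseries_split 0 (size l))//.
rewrite eseries0 ?adde0; last first.
  move=> k; rewrite add0n => kl _.
  by rewrite /hausdorff_weight /U ltnNge kl/=; case: asboolP.
rewrite add0n /cover_cost (big_nth (0, 0)) -sumEFin.
rewrite big_nat [X in (_ <= X)%E]big_nat; apply: lee_sum => k /andP[_ kl].
rewrite /hausdorff_weight; case: asboolP => [_|U0].
  by rewrite lee_fin powR_ge0.
rewrite -poweR_EFin; apply: gt0_ler_poweR; rewrite ?(ltW s0) ?diamU//.
  rewrite in_itv/= leey andbT; have /set0P[x Ux] : U k != set0 by exact/eqP.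
  apply: ereal_sup_ubound; exists x => //; exists x => //.
  by rewrite subrr normr0.
rewrite in_itv/= leey andbT lee_fin subr_ge0; apply: lle; exact: mem_nth.
Qed.

(** Below the dimension some premeasure at a scale [d] is positive. A cover by
    intervals of length at most [d] costs at least that premeasure, and a single
    longer interval costs at least [d `^ s]. *)
Lemma hausdorff_dim_content s A : 0 < s -> (s%:E < hausdorff_dim A)%E ->
  exists2 k : R, 0 < k & forall l, interval_cover A l -> k <= cover_cost s l.
Proof.
move=> s0 sA.
have H0 : hausdorff_measure s A <> 0%E.
  move=> H0; move: sA; apply/negP; rewrite -leNgt.
  by apply: ereal_inf_lbound; exists s => //; split=> //; exact: ltW.
have w0 V : (0 <= hausdorff_weight s V)%E.
  by rewrite /hausdorff_weight; case: ifP => // _; exact: poweR_ge0.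
have P0 d : (0 <= hausdorff_premeasure s d A)%E.
  by apply: le_ereal_inf_tmp => _ [U _ <-]; exact: nneseries_ge0.
have [d d0 Pd] : exists2 d : R, 0 < d & (0 < hausdorff_premeasure s d A)%E.
  apply: contrapT => nP; apply: H0; apply/eqP; rewrite eq_le; apply/andP; split.
    apply: ge_ereal_sup => _ [d /= d0 <-]; rewrite leNgt; apply/negP => Pd.
    by apply: nP; exists d.
  by apply: le_trans (P0 1) _; apply: ereal_sup_ubound; exists 1 => //=.
have [k0 k00 Pk0] : exists2 k0 : R, 0 < k0 & (k0%:E <= hausdorff_premeasure s d A)%E.
  move: Pd; case: (hausdorff_premeasure s d A) => [r r0|_|//].
    by exists r; rewrite -?lte_fin.
  by exists 1 => //; rewrite leey.
exists (Num.min k0 (d `^ s)); first by rewrite lt_min k00 powR_gt0.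
move=> l lA; rewrite ge_min.
have [ld|/allPn[p pl]] := boolP (all (fun p => p.2 - p.1 <= d) l).
  rewrite -lee_fin (le_trans Pk0)//; apply: hausdorff_premeasure_le_cost => //.
  exact/allP.
rewrite -ltNge => dp; apply/orP; right.
rewrite /cover_cost (big_rem p pl)/= ler_wpDr ?cover_cost_ge0//.
apply: ge0_ler_powR; rewrite ?nnegrE ?(ltW s0)//; first exact: ltW.
  by rewrite ltW// (lt_trans d0).
exact: ltW.
Qed.

Lemma exp_lt_eps (q c e : R) : 0 <= q < 1 -> 0 < e -> exists n, c * q ^+ n < e.
Proof.
move=> /andP[q0 q1] e0.
have /cvgrPdist_lt/(_ e e0) : @geometric R c q @ \oo --> 0.
  by apply: cvg_geometric; rewrite ger0_norm.
move=> [n _ /(_ n (leqnn _))]/=; rewrite sub0r normrN /geometric/= => H.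
by exists n; apply: le_lt_trans H; exact: ler_norm.
Qed.

(** Bisecting an interval [n] times multiplies the cost by [(2 / 2 `^ s) ^+ n],
    which is small for [s > 1]. *)
Lemma hausdorff_dim_bounded A M : A `<=` `[-M, M] -> (hausdorff_dim A <= 1)%E.
Proof.
move=> AM; rewrite leNgt; apply/negP => dA.
have [s s1 sA] : exists2 s : R, 1 < s & (s%:E < hausdorff_dim A)%E.
  move: dA; case: (hausdorff_dim A) => [r r1|_|//]; last first.
    by exists 2; rewrite ?ltry//; lra.
  by exists ((1 + r) / 2); rewrite ?lte_fin; move: r1; rewrite lte_fin; lra.
have s0 : 0 < s by rewrite (lt_trans ltr01).
have [k k0 Hk] := hausdorff_dim_content s0 sA.
have bis n x y : x <= y -> exists2 l, interval_cover `[x, y] l &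
    cover_cost s l = (y - x) `^ s * (2 * 2^-1 `^ s) ^+ n.
  elim: n x y => [|n IH] x y xy.
    exists [:: (x, y)]; last by rewrite /cover_cost big_seq1 expr0 mulr1.
    split=> [p|z]; first by rewrite inE => /eqP ->.
    by rewrite /= in_itv/= => zxy; exists (x, y); rewrite ?inE.
  pose z := (x + y) / 2.
  have xz : x <= z by rewrite /z; lra.
  have zy : z <= y by rewrite /z; lra.
  have [l1 [l1a l1b] c1] := IH x z xz; have [l2 [l2a l2b] c2] := IH z y zy.
  exists (l1 ++ l2).
    split=> [p|t].
      by rewrite mem_cat => /orP[/l1a|/l2a].
    rewrite /= in_itv/= => /andP[xt ty].
    have [tz|/ltW zt] := leP t z.
      have [|p pl tp] := l1b t; first by rewrite /= in_itv/= xt.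
      by exists p; rewrite // mem_cat pl.
    have [|p pl tp] := l2b t; first by rewrite /= in_itv/= zt.
    by exists p; rewrite // mem_cat pl orbT.
  rewrite /cover_cost big_cat/= -/(cover_cost s l1) -/(cover_cost s l2) c1 c2.
  have -> : z - x = (y - x) * 2^-1 by rewrite /z; lra.
  have -> : y - z = (y - x) * 2^-1 by rewrite /z; lra.
  by rewrite powRM ?subr_ge0// exprS; ring.
have [AE|/set0P[x0 /AM]] := eqVneq A set0.
  have /Hk : interval_cover A [::] by split=> // x; rewrite AE.
  by rewrite /cover_cost big_nil leNgt k0.
rewrite /= in_itv/= => /andP[? ?].
have MM : - M <= M by lra.
have q1 : 0 <= 2 * 2^-1 `^ s < 1.
  rewrite mulr_ge0 ?powR_ge0//= -ltr_pdivlMl// mulr1.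
  rewrite -[ltRHS]powRr1//.
  have h : (2^-1 : R) `^ s = expR (s * ln 2^-1) by rewrite /powR invr_eq0 pnatr_eq0.
  have h' : (2^-1 : R) `^ 1 = expR (1 * ln 2^-1) by rewrite /powR invr_eq0 pnatr_eq0.
  rewrite h h' ltr_expR ltr_nM2r//; apply: ln_lt0.
  by rewrite invr_gt0 ltr0n/=; lra.
have [n hn] := exp_lt_eps ((M - - M) `^ s) q1 k0.
have [l [la lb] lc] := bis n _ _ MM.
have /Hk : interval_cover A l by split=> // x /AM; exact: lb.
by rewrite lc leNgt hn.
Qed.

End Content.

(** * A Frostman measure on a compact subset of the line *)
Section Frostman.
Context {R : realType}.
Variables (K : set R) (s M k : R).
Hypothesis KM : K `<=` `[-M, M].
Hypothesis M0 : 0 <= M.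

Definition costs_upto (x : R) : set R :=
  [set cover_cost s l | l in [set l | interval_cover (K `&` `]-oo, x]) l]].

(** The distribution function of a Frostman measure on [K]. *)
Definition content_upto (x : R) : R := inf (costs_upto x).

Let costs_lb x : lbound (costs_upto x) 0.
Proof. by move=> _ [l _ <-]; exact: cover_cost_ge0. Qed.

Let costs_has_inf x : has_inf (costs_upto x).
Proof.
split; last by exists 0; exact: costs_lb.
exists (cover_cost s [:: (-M, M)]); exists [:: (-M, M)] => //; split.
  by move=> p; rewrite inE => /eqP -> /=; rewrite (le_trans _ M0)// oppr_le0.
by move=> z [/KM]; rewrite /= in_itv/= => zM _; exists (-M, M); rewrite ?inE.
Qed.

Let content_le x l : interval_cover (K `&` `]-oo, x]) l ->
  content_upto x <= cover_cost s l.
Proof.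
by move=> H; apply: ge_inf; [exact: (costs_has_inf x).2|exists l].
Qed.

Let le_content x z : (forall l, interval_cover (K `&` `]-oo, x]) l ->
  z <= cover_cost s l) -> z <= content_upto x.
Proof.
move=> H; apply: lb_le_inf; first exact: (costs_has_inf x).1.
by move=> _ [l lK <-]; exact: H.
Qed.

Lemma content_upto_nondecreasing x y : x <= y -> content_upto x <= content_upto y.
Proof.
move=> xy; apply: le_content => l [l1 l2]; apply: content_le; split=> // z [Kz].
rewrite /= in_itv/= => zx; apply: l2; split=> //.
by rewrite /= in_itv/= (le_trans zx).
Qed.

(** Adding the interval [[x, y]] to a cover of the part of [K] up to [x] covers the
    part up to [y]. This replaces the usual construction of a Frostman measure on
    the dyadic tree. *)
Lemma content_upto_holder x y : x <= y ->
  content_upto y - content_upto x <= (y - x) `^ s.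
Proof.
move=> xy; rewrite lerBlDr addrC -lerBlDr; apply: le_content => l [l1 l2].
rewrite lerBlDr addrC; apply: (@le_trans _ _ (cover_cost s ((x, y) :: l))).
  apply: content_le; split=> [p|z [Kz]].
    by rewrite inE => /orP[/eqP ->//|/l1].
  rewrite /= in_itv/= => zy; have [zx|/ltW xz] := leP z x.
    have [|p pl zp] := l2 z; first by split=> //; rewrite /= in_itv.
    by exists p; rewrite // inE pl orbT.
  by exists (x, y); rewrite ?inE ?eqxx//= xz.
by rewrite /cover_cost big_cons.
Qed.

Lemma content_upto_support x y : content_upto x < content_upto y ->
  exists2 z, K z & x < z <= y.
Proof.
move=> xy; apply: contrapT => H; move: xy; apply/negP; rewrite -leNgt.
apply: le_content => l [l1 l2]; apply: content_le; split=> // z [Kz].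
rewrite /= in_itv/= => zy; apply: l2; split=> //; rewrite /= in_itv/=.
by rewrite leNgt; apply/negP => xz; apply: H; exists z => //; rewrite xz.
Qed.

Lemma content_upto_mass (x y : R) : x < - M -> M <= y ->
  (forall l, interval_cover K l -> k <= cover_cost s l) ->
  k <= content_upto y - content_upto x.
Proof.
move=> xM My kK.
have -> : content_upto x = 0.
  apply/eqP; rewrite eq_le; apply/andP; split; last first.
    by apply: le_content => l _; exact: cover_cost_ge0.
  have <- : cover_cost s [::] = 0 by rewrite /cover_cost big_nil.
  apply: content_le; split=> // z [/KM]; rewrite /= !in_itv/= => /andP[? _] ?; lra.
rewrite subr0; apply: le_content => l [l1 l2]; apply: kK; split=> // z Kz.
apply: l2; split=> //; move: (KM Kz); rewrite /= !in_itv/= => /andP[_ ?]; lra.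
Qed.

End Frostman.

(** * Discretization and sums over pairs *)
Section GridMass.
Context {R : realType}.
Variables (phi : R -> R) (s x0 r : R).
Hypothesis phi_nd : forall x y, x <= y -> phi x <= phi y.
Hypothesis phi_holder : forall x y, x <= y -> phi y - phi x <= (y - x) `^ s.
Hypothesis r0 : 0 < r.

Definition grid (k : nat) : R := x0 + k%:R * r.
Definition grid_mass (k : nat) : R := phi (grid k.+1) - phi (grid k).

Let gridS k : grid k.+1 = grid k + r.
Proof. by rewrite /grid -natr1 mulrDl mul1r addrA. Qed.

Lemma grid_mass_ge0 k : 0 <= grid_mass k.
Proof. by rewrite subr_ge0 phi_nd// gridS lerDl ltW. Qed.

Lemma sum_grid_mass n : \sum_(k <- iota 0 n) grid_mass k = phi (grid n) - phi x0.
Proof.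
have := @telescope_sumr _ 0 n (phi \o grid) (leq0n n).
by rewrite /grid /= mul0r addr0 => <-; rewrite /index_iota subn0.
Qed.

(** Truncating [phi] outside the interval keeps the terms of the sum and makes it
    telescope. *)
Lemma sum_grid_mass_itv n y z : y <= z + r ->
  \sum_(k <- iota 0 n | y <= grid k <= z) grid_mass k <= (z + r - y) `^ s.
Proof.
move=> yz; pose psi x := phi (Num.max y (Num.min x (z + r))).
have psi_nd : {homo psi : x x' / x <= x'}.
  by move=> x x' xx'; apply: phi_nd; rewrite le_max2// le_min2.
apply: (@le_trans _ _ (\sum_(k <- iota 0 n) (psi (grid k.+1) - psi (grid k)))).
  rewrite big_mkcond; apply: ler_sum => k _; case: ifPn => [/andP[yk kz]|_].
    rewrite /psi /grid_mass gridS !min_l ?lerD2r//; last by rewrite (le_trans kz)// lerDl ltW.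
    by rewrite !max_r// (le_trans yk)// lerDl ltW.
  by rewrite subr_ge0 psi_nd// gridS lerDl ltW.
have := @telescope_sumr _ 0 n (psi \o grid) (leq0n n).
rewrite /index_iota subn0 /= => ->.
apply: le_trans (phi_holder yz); rewrite lerB// phi_nd//.
  by rewrite ge_max yz ge_min lexx orbT.
by rewrite le_max lexx.
Qed.

(** [X] vanishes unless the two grid points are within [D], and a window of
    radius [D] carries a mass at most [(2 * D + r) `^ s]. *)
Lemma sum_grid_mass_pairs n (X : nat -> nat -> R) V D : 0 <= V -> 0 <= D ->
  (forall k k', X k k' <= V) ->
  (forall k k', D < `|grid k - grid k'| -> X k k' <= 0) ->
  \sum_(k <- iota 0 n) \sum_(k' <- iota 0 n) grid_mass k * grid_mass k' * X k k'
    <= V * (phi (grid n) - phi x0) * (2 * D + r) `^ s.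
Proof.
move=> V0 D0 XV XD; rewrite -sum_grid_mass mulr_sumr mulr_suml.
apply: ler_sum => k _.
apply: (@le_trans _ _ (\sum_(k' <- iota 0 n | grid k - D <= grid k' <= grid k + D)
    V * grid_mass k * grid_mass k')).
  rewrite [leRHS]big_mkcond; apply: ler_sum => k' _.
  rewrite -ler_distl distrC; case: ifPn => kk'.
    by rewrite mulrC mulrA ler_wpM2r ?grid_mass_ge0// ler_wpM2r ?grid_mass_ge0.
  by rewrite mulr_ge0_le0 ?mulr_ge0 ?grid_mass_ge0// XD// ltNge.
rewrite -mulr_sumr ler_wpM2l ?mulr_ge0 ?grid_mass_ge0//.
have kD : grid k - D <= grid k + D + r.
  by move: r0 D0; set gk := grid k; lra.
apply: (le_trans (sum_grid_mass_itv _ kD)).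
by rewrite le_eqVlt; apply/orP; left; apply/eqP; congr (_ `^ _); ring.
Qed.

End GridMass.

Section TreeEnergy.
Context {R : realType} {W : finType}.
Variables (q : W -> R).
Hypothesis q0 : forall i, 0 <= q i.
Hypothesis q1 : \sum_i q i = 1.

Fixpoint words (n : nat) : seq (seq W) :=
  if n is n'.+1 then [seq i :: v | i <- enum W, v <- words n'] else [:: [::]].

Lemma sum_words_recl n (f : seq W -> R) :
  \sum_(v <- words n.+1) f v = \sum_i \sum_(v <- words n) f (i :: v).
Proof. by rewrite big_allpairs_dep/= big_enum. Qed.

Lemma mem_words n v : (v \in words n) = (size v == n).
Proof.
elim: n v => [|n IH] [|i v] //=.
  by apply/negP => /allpairsP[[j w] []].
rewrite eqSS -IH; apply/allpairsP/idP => [[[j w] [/= _ wn [_ ->]]]//|vn].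
by exists (i, v); rewrite mem_enum.
Qed.

Lemma sum_words_prod n (f : W -> R) :
  \sum_(v <- words n) \prod_(i <- v) f i = (\sum_i f i) ^+ n.
Proof.
elim: n => [|n IH]; first by rewrite /= big_seq1 big_nil expr0.
rewrite sum_words_recl exprS mulr_suml; apply: eq_bigr => i _.
by rewrite -IH mulr_sumr; apply: eq_bigr => v _; rewrite big_cons.
Qed.

Definition weight (v : seq W) : R := \prod_(i <- v) q i.

Lemma weight_ge0 v : 0 <= weight v.
Proof. by apply: prodr_ge0. Qed.

Lemma weight_cons i v : weight (i :: v) = q i * weight v.
Proof. by rewrite /weight big_cons. Qed.

Lemma weight_cat u v : weight (u ++ v) = weight u * weight v.
Proof. by rewrite /weight big_cat. Qed.

Lemma weight_rcons u i : weight (rcons u i) = weight u * q i.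
Proof. by rewrite -cats1 weight_cat weight_cons /weight big_nil mulr1. Qed.

Lemma sum_weight n : \sum_(v <- words n) weight v = 1.
Proof. by rewrite sum_words_prod q1 expr1n. Qed.

(** Sorting the pairs of words by their longest common prefix: the pairs that
    split after a prefix [u] have total weight at most [weight u ^+ 2]. *)
Lemma tree_energy_le (G : seq W -> seq W -> R) (B : nat -> R) (n0 n1 N : nat) u :
  (forall k, 0 <= B k) ->
  (forall u i j v v', (n0 <= size u)%N -> i != j ->
     weight u * G (u ++ i :: v) (u ++ j :: v') <= B (size u)) ->
  (forall u, size u = n1 -> weight u * G u u <= B (size u)) ->
  (n0 <= size u)%N -> (size u + N = n1)%N ->
  weight u * (\sum_(v <- words N) \sum_(v' <- words N)
     weight v * weight v' * G (u ++ v) (u ++ v')) <=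
  \sum_(k <- iota 0 N.+1) B (size u + k)%N.
Proof.
move=> B0 Boff Bdiag; elim: N u => [|N IH] u un0 uN.
  rewrite /= !big_seq1 !cats0 /weight !big_nil !mul1r addn0.
  by apply: Bdiag; rewrite -uN addn0.
rewrite sum_words_recl mulr_sumr.
set S := \sum_(k <- iota 0 N.+1) B ((size u).+1 + k)%N.
have S0 : 0 <= S by apply: sumr_ge0.
have -> : \sum_(k <- iota 0 N.+2) B (size u + k)%N = B (size u) + S.
  have -> : iota 0 N.+2 = 0%N :: iota (1 + 0) N.+1 by [].
  rewrite big_cons addn0 /S (iotaDl 1 0 N.+1) big_map; congr (_ + _).
  by apply: eq_bigr => k _; rewrite add1n addSnnS.
have term i j : weight u * (\sum_(v <- words N) \sum_(v' <- words N)
    weight (i :: v) * weight (j :: v') * G (u ++ i :: v) (u ++ j :: v')) <=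
    q i * q j * B (size u) + (i == j)%:R * (q i * S).
  have [->|ij] := eqVneq i j; last first.
    rewrite mul0r addr0 mulr_sumr.
    apply: (@le_trans _ _ (\sum_(v <- words N) \sum_(v' <- words N)
      q i * q j * B (size u) * (weight v * weight v'))).
      apply: ler_sum => v _; rewrite mulr_sumr; apply: ler_sum => v' _.
      rewrite !weight_cons.
      rewrite [leLHS](_ : _ = q i * q j * (weight v * weight v') *
        (weight u * G (u ++ i :: v) (u ++ j :: v'))); last by ring.
      rewrite [leRHS](_ : _ = q i * q j * (weight v * weight v') * B (size u)); last by ring.
      by rewrite ler_wpM2l ?Boff// !mulr_ge0 ?weight_ge0.
    under eq_bigr do rewrite -mulr_sumr -mulr_sumr sum_weight mulr1.
    by rewrite -mulr_sumr sum_weight mulr1.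
  rewrite mul1r ler_wpDl ?mulr_ge0//.
  have := IH (rcons u j); rewrite size_rcons => /(_ (leqW un0)).
  rewrite addSnnS => /(_ uN).
  rewrite weight_rcons => /(ler_wpM2l (q0 j)).
  apply: le_trans; rewrite le_eqVlt; apply/orP; left; apply/eqP.
  rewrite !mulr_sumr; apply: eq_bigr => v _; rewrite !mulr_sumr; apply: eq_bigr => v' _.
  by rewrite !cat_rcons !weight_cons; ring.
apply: (@le_trans _ _ (\sum_i \sum_j (q i * q j * B (size u) + (i == j)%:R * (q i * S)))).
  apply: ler_sum => i _.
  have -> : \sum_(v <- words N) \sum_(v' <- words N.+1) weight (i :: v) * weight v' *
      G (u ++ i :: v) (u ++ v') = \sum_j \sum_(v <- words N) \sum_(v' <- words N)
      weight (i :: v) * weight (j :: v') * G (u ++ i :: v) (u ++ j :: v').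
    by under eq_bigr do rewrite sum_words_recl; rewrite exchange_big.
  by rewrite mulr_sumr; apply: ler_sum => j _.
under eq_bigr => i _.
  rewrite big_split/= -mulr_suml -mulr_sumr q1 mulr1.
  rewrite (bigD1 i)//= eqxx mul1r big1 ?addr0; last first.
    by move=> j ji; rewrite eq_sym (negPf ji) mul0r.
  over.
by rewrite big_split/= -!mulr_suml q1 !mul1r.
Qed.

End TreeEnergy.

Section Exponents.
Context {R : realType}.

Lemma prod_powR (I : Type) (u : seq I) (x : I -> R) p : (forall i, 0 <= x i) ->
  (\prod_(i <- u) x i) `^ p = \prod_(i <- u) x i `^ p.
Proof.
move=> x0; elim: u => [|i u IH]; first by rewrite !big_nil powR1.
by rewrite !big_cons powRM ?IH// prodr_ge0.
Qed.

Lemma le0_ler_powR (p x y : R) : p <= 0 -> 0 < x -> x <= y -> y `^ p <= x `^ p.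
Proof.
move=> p0 x0 xy; rewrite -(opprK p) !(powRN _ (- p)).
have y0 : 0 < y by exact: lt_le_trans xy.
rewrite lef_pV2 ?posrE ?powR_gt0//; apply: ge0_ler_powR;
  by rewrite ?oppr_ge0// nnegrE ltW.
Qed.

(** Contribution of the pairs of words that split in a cylinder of size about [U].
    If [r <= U], transversality bounds the measure [V] of the parameters by
    [16 * r / (gap * L)]; if [U < r], the bound [V <= 1] is enough because [s <= 1].
    In both cases [r] comes out to the first power and a positive power of [U] is
    left. *)
Lemma energy_exponents (s t e U L r V gap m : R) :
  0 < s <= 1 -> 0 < t < 1 -> 0 <= e -> 0 < gap ->
  0 < L -> L <= U -> U <= 1 -> U `^ (1 + e) <= L -> 0 < r ->
  0 <= m <= L `^ t -> 0 <= V <= 1 -> V <= 16 * r / (gap * L) \/ U < r ->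
  m * (V * (2 * (2 * r + U) + r) `^ s) <=
    7 `^ s * (16 / gap + 1) * r * U `^ (s - (1 + e) * (1 - t)).
Proof.
move=> /andP[s0 s1] /andP[t0 t1] e0 gap0 L0 LU U1 UL r0 /andP[m0 mL] /andP[V0 V1] VU.
have U0 : 0 < U by exact: lt_le_trans LU.
have split_r X : 0 <= X -> X <= 7 `^ s * (16 / gap) * r * U `^ (s - (1 + e) * (1 - t)) \/
    X <= 7 `^ s * r * U `^ (s - (1 + e) * (1 - t)) ->
    X <= 7 `^ s * (16 / gap + 1) * r * U `^ (s - (1 + e) * (1 - t)).
  move=> X0; set P := U `^ _; have P0 : 0 <= P by exact: powR_ge0.
  have h1 : 0 <= 7 `^ s * (16 / gap) * r * P.
    by rewrite !mulr_ge0 ?powR_ge0 ?invr_ge0// ltW.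
  have h2 : 0 <= 7 `^ s * r * P by rewrite !mulr_ge0 ?powR_ge0// ltW.
  by case=> h; lra.
apply: split_r; first by rewrite !mulr_ge0 ?powR_ge0.
have nn (x : R) : 0 < x -> x \is Num.nneg by move=> x0; rewrite nnegrE ltW.
have [rU|Ur] := leP r U; [left|right].
  have Vl : V <= 16 * r / (gap * L) by case: VU => //; rewrite ltNge rU.
  have h1 : (2 * (2 * r + U) + r) `^ s <= 7 `^ s * U `^ s.
    rewrite -powRM//; last exact: ltW.
    by apply: ge0_ler_powR; rewrite ?nn ?(ltW s0)//; lra.
  have h2 : m * V <= 16 / gap * r * U `^ ((1 + e) * (t - 1)).
    apply: (@le_trans _ _ (L `^ t * (16 * r / (gap * L)))); first exact: ler_pM.
    have -> : L `^ t * (16 * r / (gap * L)) = 16 / gap * r * (L `^ t / L).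
      by rewrite invfM; ring.
    rewrite ler_wpM2l//; first by rewrite !mulr_ge0 ?invr_ge0// ltW.
    rewrite -{2}(powRr1 (ltW L0)) -powRB ?(gt_eqF L0) ?implybT//.
    have tle : t - 1 <= 0 by lra.
    by rewrite powRrM (le0_ler_powR tle _ UL)// powR_gt0.
  rewrite mulrA; apply: (le_trans (ler_pM _ _ h2 h1)); rewrite ?mulr_ge0 ?powR_ge0//.
  rewrite (_ : s - (1 + e) * (1 - t) = s + (1 + e) * (t - 1)); last by ring.
  by rewrite (@powRD _ U) ?(gt_eqF U0) ?implybT// le_eqVlt; apply/orP; left; apply/eqP; ring.
have h1 : (2 * (2 * r + U) + r) `^ s <= 7 `^ s * (r * U `^ (s - 1)).
  apply: (@le_trans _ _ (7 `^ s * r `^ s)).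
    rewrite -powRM//; last exact: ltW.
    by apply: ge0_ler_powR; rewrite ?nn ?(ltW s0)//; lra.
  rewrite ler_wpM2l ?powR_ge0//.
  have -> : r `^ s = r * r `^ (s - 1).
    rewrite -{2}(powRr1 (ltW r0)) -powRD ?(gt_eqF r0) ?implybT//.
    by congr (_ `^ _); ring.
  have sle : s - 1 <= 0 by lra.
  by rewrite ler_wpM2l ?(ltW r0)// (le0_ler_powR sle U0)// ltW.
have h2 : m * V <= U `^ t.
  apply: (@le_trans _ _ (L `^ t * 1)); first exact: ler_pM.
  by rewrite mulr1; apply: ge0_ler_powR; rewrite ?nn ?(ltW t0).
rewrite mulrA; apply: (le_trans (ler_pM _ _ h2 h1)); rewrite ?mulr_ge0 ?powR_ge0//.
rewrite [leLHS](_ : _ = 7 `^ s * r * (U `^ t * U `^ (s - 1))); last by ring.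
rewrite ler_wpM2l ?mulr_ge0 ?powR_ge0 ?(ltW r0)//.
rewrite -powRD ?(gt_eqF U0) ?implybT//; apply: ger_powR; rewrite ?U0//.
have : 0 <= e * (1 - t) by rewrite mulr_ge0// subr_ge0 ltW.
lra.
Qed.

End Exponents.

(** * From bounded energy to positive measure *)
Section StepFunctions.
Context d (T : measurableType d) (R : realType).
Variable mu : {measure set T -> \bar R}.
Variables (I : Type) (l : seq I) (c : I -> R) (S : I -> set T).
Hypothesis c0 : forall i, 0 <= c i.
Hypothesis mS : forall i, measurable (S i).

Definition step_sum (x : T) : R := \sum_(i <- l) c i * \1_(S i) x.

Lemma step_sum_ge0 x : 0 <= step_sum x.
Proof. by apply: sumr_ge0 => i _; rewrite mulr_ge0. Qed.

Lemma measurable_step_sum D : measurable_fun D step_sum.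
Proof.
apply: measurable_sum => i; apply: measurable_funM; first exact: measurable_cst.
exact: measurable_indic.
Qed.

Lemma integral_step_sum D : measurable D ->
  (\int[mu]_(x in D) (step_sum x)%:E = \sum_(i <- l) (c i)%:E * mu (S i `&` D))%E.
Proof.
move=> mD; under eq_integral do rewrite /step_sum -sumEFin.
rewrite ge0_integral_sum//; last 2 first.
- move=> i; apply/measurable_EFinP; apply: measurable_funM; first exact: measurable_cst.
  exact: measurable_indic.
- by move=> i x _; rewrite lee_fin mulr_ge0.
apply: eq_bigr => i _; under eq_integral do rewrite EFinM.
rewrite ge0_integralZl_EFin//; last exact/measurable_EFinP/measurable_indic.
by rewrite integral_indic.
Qed.

End StepFunctions.

Section MassEnergy.
Context {R : realType}.
Local Notation mu := (@lebesgue_measure R).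

(** Cauchy-Schwarz for the density [sum_i w_i 1_[y_i - r, y_i + r]], in the
    pointwise form [f <= t f^2 + 1_Z / (4 t)]. *)
Lemma mass_energy (I : eqType) (l : seq I) (w y : I -> R) (r B : R) (Z : set R) :
  0 < r -> 0 < B -> (forall i, 0 <= w i) -> 0 < \sum_(i <- l) w i ->
  measurable Z ->
  (forall i, i \in l -> 0 < w i -> `[y i - r, y i + r] `<=` Z) ->
  \sum_(i <- l) \sum_(j <- l) w i * w j * (`|y i - y j| <= 2 * r)%R%:R <= B * r ->
  ((2 * (\sum_(i <- l) w i) ^+ 2 / B)%:E <= mu Z)%E.
Proof.
move=> r0 B0 w0 m0 mZ yZ EB; set m := \sum_(i <- l) w i in m0 *.
pose Iv i : set R := `[y i - r, y i + r]%classic.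
(* For this [t] the energy term is at most half of the mass [2 * r * m]. *)
have [t t0 tE] : exists2 t : R, 0 < t & t = m / (2 * B * r).
  by eexists; last reflexivity; rewrite divr_gt0// !mulr_gt0.
(* The right-hand side is written as a single sum over [option (I * I)], where
   [None] stands for [Z]. *)
pose Il := None :: [seq Some p | p <- [seq (i, j) | i <- l, j <- l]].
pose c (o : option (I * I)) := if o is Some p then t * (w p.1 * w p.2) else (4 * t)^-1.
pose S (o : option (I * I)) := if o is Some p then Iv p.1 `&` Iv p.2 else Z.
have c0 o : 0 <= c o.
  by case: o => [p|]/=; rewrite ?invr_ge0 !mulr_ge0// ltW.
have mIv i : measurable (Iv i) by exact: measurable_itv.
have mS o : measurable (S o) by case: o => [p|]//=; exact: measurableI.
have lenI (x : R) : mu `[x - r, x + r]%classic = (2 * r)%:E.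
  by rewrite lebesgue_measure_itv/= lte_fin ifT -?EFinB; [congr EFin; ring|lra].
have pointwise z : step_sum l w Iv z <= step_sum Il c S z.
  rewrite [leRHS]/step_sum big_cons big_map big_allpairs/=.
  have -> : \sum_(i <- l) \sum_(j <- l) t * (w i * w j) * \1_(Iv i `&` Iv j) z =
      t * step_sum l w Iv z ^+ 2.
    rewrite expr2 /step_sum mulr_suml mulr_sumr; apply: eq_bigr => i _.
    rewrite mulr_sumr mulr_sumr; apply: eq_bigr => j _.
    by rewrite indicI /=; ring.
  have f0 : 0 <= step_sum l w Iv z by exact: step_sum_ge0.
  have [Zz|Zz] := pselect (Z z).
    rewrite indicE mem_set//= mulr1; set f := step_sum _ _ _ _ in f0 *.
    rewrite -subr_ge0 (_ : _ - f = t * (f - (2 * t)^-1) ^+ 2).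
      by rewrite mulr_ge0 ?sqr_ge0// ltW.
    by field; rewrite gt_eqF.
  rewrite (_ : step_sum l w Iv z = 0); first by rewrite expr0n/= mulr0 addr0 mulr_ge0 ?c0// invr_ge0 mulr_ge0// ltW.
  rewrite /step_sum big_seq big1// => i il.
  have [wi|] := ltP 0 (w i); last first.
    by move=> wi; rewrite (_ : w i = 0) ?mul0r//; apply/eqP; rewrite eq_le wi w0.
  by rewrite indicE memNset ?mulr0// => /(yZ i il wi).
have := @ge0_le_integral _ _ _ mu setT measurableT
  (fun z => (step_sum l w Iv z)%:E) (fun z => (step_sum Il c S z)%:E).
rewrite (integral_step_sum mu l w0 mIv measurableT) (integral_step_sum mu Il c0 mS measurableT).
have f1 z : setT z -> (0 <= (step_sum l w Iv z)%:E)%E by rewrite lee_fin step_sum_ge0.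
have m1 (J : Type) (k : seq J) (f : J -> R) (U : J -> set R) : (forall i, measurable (U i)) ->
    measurable_fun [set: R] (fun z => (step_sum k f U z)%:E).
  by move=> mU; apply/measurable_EFinP; exact: measurable_step_sum.
have f2 z : setT z -> ((step_sum l w Iv z)%:E <= (step_sum Il c S z)%:E)%E by rewrite lee_fin.
move=> /(_ f1 (m1 _ _ _ _ mIv) (m1 _ _ _ _ mS) f2).
rewrite big_cons big_map big_allpairs/= setIT.
have -> : (\sum_(i <- l) (w i)%:E * mu (Iv i `&` setT) = (2 * r * m)%:E)%E.
  rewrite mulr_sumr -sumEFin; apply: eq_bigr => i _.
  by rewrite setIT lenI -EFinM mulrC.
have : (\sum_(i <- l) \sum_(j <- l) (t * (w i * w j))%:E * mu (Iv i `&` Iv j `&` setT)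
    <= (t * (2 * r) * (B * r))%:E)%E.
  apply: (@le_trans _ _ (t * (2 * r) * (\sum_(i <- l) \sum_(j <- l) w i * w j * (`|y i - y j| <= 2 * r)%R%:R))%:E).
    rewrite mulr_sumr -sumEFin; apply: lee_sum => i _.
    rewrite mulr_sumr -sumEFin; apply: lee_sum => j _.
    have t0' := ltW t0.
    have [ij|ij] := boolP (`|y i - y j| <= 2 * r); rewrite setIT.
      apply: (@le_trans _ _ ((t * (w i * w j))%:E * (2 * r)%:E)%E).
        rewrite lee_wpmul2l// ?lee_fin ?mulr_ge0// -(lenI (y i)).
        by apply: le_outer_measure; exact: subIsetl.
      by rewrite -EFinM lee_fin mulr1 le_eqVlt; apply/orP; left; apply/eqP; ring.
    suff -> : Iv i `&` Iv j = set0 by rewrite measure0 mule0 !mulr0.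
    apply/seteqP; split=> // z []; rewrite /Iv /= !in_itv/= => /andP[? ?] /andP[? ?].
    by move: ij; apply/negP/negPn; rewrite ler_norml; apply/andP; split; lra.
  by rewrite lee_fin ler_wpM2l// !mulr_ge0// ltW.
set X := (\sum_(i <- l) _)%E => XB H.
have {H XB} H : ((2 * r * m)%:E <= (4 * t)^-1%:E * mu Z + (t * (2 * r) * (B * r))%:E)%E.
  by apply: (le_trans H); rewrite leeD2l.
have [->|muZ] := eqVneq (mu Z) +oo%E; first by rewrite leey.
have Zfin : mu Z \is a fin_num by rewrite ge0_fin_numE// ltey.
move: H; rewrite -(fineK Zfin) -EFinM -EFinD !lee_fin.
set z := fine _ => H.
have h4 : (4 * t)^-1 * z = B * r / (2 * m) * z by rewrite tE; field; rewrite !gt_eqF.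
have h5 : t * (2 * r) * (B * r) = r * m by rewrite tE; field; rewrite !gt_eqF.
rewrite ler_pdivrMr//.
have : r * m <= B * r / (2 * m) * z by rewrite -h4; lra.
rewrite mulrAC ler_pdivlMr ?mulr_gt0// => h6.
rewrite -(ler_pM2r r0); lra.
Qed.

(** Fatou's lemma: the lower limit of [E] is integrable, hence finite almost
    everywhere. *)
Lemma frequently_bounded_ae (D : set R) (E : nat -> R -> R) (B : R) :
  measurable D -> (forall j, measurable_fun D (E j)) ->
  (forall j x, 0 <= E j x) ->
  (forall j, \int[mu]_(x in D) (E j x)%:E <= B%:E)%E ->
  {ae mu, forall x, D x ->
     exists2 b, 0 < b & forall N, exists2 j, (N <= j)%N & E j x <= b}.
Proof.
move=> mD mE E0 EB.
pose f j x := (E j x)%:E.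
have mf j : measurable_fun D (f j) by apply/measurable_EFinP; exact: mE.
have f0 j x : D x -> (0 <= f j x)%E by rewrite lee_fin.
have einf0 x : (0 <= limn_einf (f^~ x))%E.
  rewrite limn_einf_lim; apply: lime_ge; first exact: is_cvg_einfs.
  near=> n; apply: le_ereal_inf_tmp => _ [k _ <-]; by rewrite lee_fin.
have mlim : measurable_fun D (fun x => limn_einf (f^~ x)).
  rewrite /limn_einf; apply: measurableT_comp; first exact: oppe_measurable.
  apply: (@measurable_fun_limn_esup _ _ _ _ (fun n x => - f n x)%E) => n.
  by apply: measurableT_comp => //; exact: oppe_measurable.
have intlim : mu.-integrable D (fun x => limn_einf (f^~ x)).
  apply/integrableP; split=> //.
  under eq_integral do rewrite gee0_abs//.
  apply: (@le_lt_trans _ _ (limn_einf (fun n => \int[mu]_(x in D) f n x)%E)).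
    exact: fatou.
  apply: (@le_lt_trans _ _ B%:E); last exact: ltry.
  rewrite limn_einf_lim; apply: lime_le; first exact: is_cvg_einfs.
  near=> n; apply: le_trans (EB n); apply: ereal_inf_lbound; exists n => //=.
have := @integrable_ae _ (measurableTypeR R) R mu D mD _ intlim.
apply: filterS => x H Dx.
have := H Dx; set L := limn_einf _ => Lfin.
exists (fine L + 1); first by rewrite ltr_wpDl// fine_ge0//; exact: einf0.
move=> N; have : (ereal_inf [set f n x | n in [set n | (N <= n)%N]] < (fine L + 1)%:E)%E.
  apply: (@le_lt_trans _ _ L); last first.
    by rewrite -[X in (X < _)%E](fineK Lfin) lte_fin ltrDl.
  rewrite /L limn_einf_lim (cvg_lim _ (@cvg_einfs_sup _ _))//.
  by apply: ereal_sup_ubound; exists N.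
by move=> /ereal_inf_lt[_ [j Nj <-]]; rewrite lte_fin => /ltW; exists j.
Unshelve. all: by end_near.
Qed.

Lemma sumset_compact (A B : set R) : compact A -> compact B ->
  compact [set x + y | x in A & y in B].
Proof.
move=> cA cB; have -> : [set x + y | x in A & y in B] = (fun p => p.1 + p.2) @` (A `*` B).
  apply/seteqP; split=> [z [x Ax [y By <-]]|_ [[x y] [/= Ax By] <-]].
    by exists (x, y).
  by exists x => //; exists y.
apply: continuous_compact; last exact: compact_setX.
by apply: continuous_subspaceT => p; exact: add_continuous.
Qed.

Definition neighborhood (S : set R) (r : R) : set R :=
  [set z | exists2 s, S s & `|z - s| <= r].

Lemma neighborhood_compact S r : compact S -> compact (neighborhood S r).
Proof.
move=> cS; have -> : neighborhood S r = (fun p => p.1 + p.2) @` (S `*` `[-r, r]).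
  apply/seteqP; split=> [z [s Ss zs]|_ [[s x] [/= Ss xr] <-]].
    exists (s, z - s) => /=; last by ring.
    by split=> //=; rewrite in_itv/= -ler_norml.
  exists s => //; rewrite (_ : s + x - s = x); last by ring.
  by move: xr; rewrite in_itv/= -ler_norml.
apply: continuous_compact; last by apply: compact_setX => //; exact: segment_compact.
by apply: continuous_subspaceT => p; exact: add_continuous.
Qed.

(** A compact set is the decreasing intersection of its closed neighborhoods, so
    its measure is the limit of theirs. *)
Lemma neighborhood_measure_gt0 S (e : R) : compact S -> 0 < e ->
  (forall r, 0 < r -> exists2 r', r' <= r & (e%:E <= mu (neighborhood S r'))%E) ->
  (0 < mu S)%E.
Proof.
move=> cS e0 H.
have Smono r r' : r <= r' -> neighborhood S r `<=` neighborhood S r'.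
  by move=> rr' z [s Ss zs]; exists s => //; exact: le_trans rr'.
pose Zn n := neighborhood S n.+1%:R^-1.
have mZ r : measurable (neighborhood S r).
  by apply: compact_measurable; exact: neighborhood_compact.
have capZ : \bigcap_n Zn n = S.
  apply/seteqP; split=> [z Hz|s Ss n _]; last first.
    by exists s => //; rewrite subrr normr0 invr_ge0.
  have cl : closed S by apply: compact_closed => //; exact: norm_hausdorff.
  apply: cl => A /nbhs_ballP[r /= r0 rA].
  have [n nr] : exists n, n.+1%:R^-1 < r.
    exists (Num.truncn r^-1); rewrite invf_plt ?posrE//.
    exact: Num.Theory.truncnS_gt.
  have [s Ss zs] := Hz n I; exists s; split=> //.
  by apply: rA; rewrite /ball/=; apply: le_lt_trans nr.
have Zfin n : (mu (Zn n) < +oo)%E.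
  by apply: compact_finite_measure; exact: neighborhood_compact.
have cvgZ : mu \o Zn @ \oo --> mu (\bigcap_n Zn n).
  apply: nonincreasing_cvg_mu.
  - exact: (Zfin 0%N).
  - by move=> i; exact: mZ.
  - by apply: bigcap_measurable => // i _; exact: mZ.
  - move=> n m nm; apply/subsetPset; apply: Smono.
    by rewrite lef_pV2 ?posrE// ler_nat.
rewrite capZ in cvgZ.
apply: (@lt_le_trans _ _ e%:E); first by rewrite lte_fin.
rewrite -(cvg_lim _ cvgZ)//; apply: lime_ge; first by apply/cvg_ex; eexists; exact: cvgZ.
near=> n => /=; have n0 : 0 < n.+1%:R^-1 :> R by rewrite invr_gt0.
have [r' r'n er'] := H _ n0.
apply: (le_trans er'); apply: le_measure; rewrite ?inE; [exact: mZ|exact: mZ|].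
exact: Smono.
Unshelve. all: by end_near.
Qed.

End MassEnergy.

(** * The energy estimate for systems with comparable ratios *)
Section BlockSystem.
Context {R : realType} {W : finType}.
Local Notation mu := (@lebesgue_measure R).
Variables (a b Y d : R) (F : W -> R -> R -> R) (lo hi : W -> R).
Variables (gap Th s t e : R).
Hypothesis ba1 : b - a <= 1.
Hypothesis ab : a <= b.
Hypothesis dba : d * (b - a) <= 1.
Hypothesis d0 : 0 < d.
Hypothesis Y0 : 0 <= Y.
Hypothesis F_pm : forall i, parametrized_map a b Y d 1 (F i).
Hypothesis F_ratio : forall i, ratio_between a b (lo i) (hi i) (F i).
Hypothesis lo0 : forall i, 0 < lo i.
Hypothesis lohi : forall i, hi i `^ (1 + e) <= lo i.
Hypothesis hiTh : forall i, hi i <= Th.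
Hypothesis Th01 : 0 < Th < 1.
Hypothesis gap0 : 0 < gap.
Hypothesis F_gap : forall i j l x y, i != j -> a <= l <= b ->
  0 <= x <= 1 -> 0 <= y <= 1 -> gap <= `|F i l x - F j l y|.
Hypothesis s01 : 0 < s <= 1.
Hypothesis t01 : 0 < t < 1.
Hypothesis e0 : 0 <= e.
Hypothesis sigma0 : 0 < s - (1 + e) * (1 - t).
Hypothesis lo_t : 1 <= \sum_i lo i `^ t.

(** The letters get masses proportional to [lo i `^ t], so that a cylinder has mass
    at most [lo] of the cylinder to the power [t]. *)
Definition letter_mass (i : W) : R := lo i `^ t / \sum_j lo j `^ t.

Let S0 : 0 < \sum_j lo j `^ t.
Proof. by rewrite (lt_le_trans ltr01). Qed.

Lemma letter_mass_ge0 i : 0 <= letter_mass i.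
Proof. by rewrite divr_ge0 ?powR_ge0// ltW. Qed.

Lemma sum_letter_mass : \sum_i letter_mass i = 1.
Proof. by rewrite -mulr_suml divff// gt_eqF. Qed.

Let wt := weight letter_mass.
Let Lw (u : seq W) := \prod_(i <- u) lo i.
Let Uw (u : seq W) := \prod_(i <- u) hi i.

Let lo_le_hi i : lo i <= hi i.
Proof.
have aab : a <= a <= b by rewrite lexx ab.
have z0 : 0 <= (0 : R) <= 1 by rewrite lexx ler01.
have z1 : 0 <= (1 : R) <= 1 by rewrite lexx ler01.
have /andP[h1 h2] := F_ratio i aab z1 z0.
by have := le_trans h1 h2; rewrite subr0 normr1 !mulr1.
Qed.

Let hi0 i : 0 < hi i. Proof. exact: lt_le_trans (lo_le_hi i). Qed.

Let Lw_gt0 u : 0 < Lw u. Proof. exact: prodr_gt0. Qed.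

Let Lw_le_Uw u : Lw u <= Uw u.
Proof.
by rewrite /Lw /Uw; elim: u => [|i u IH]; rewrite ?big_nil// !big_cons ler_pM// ?ltW// Lw_gt0.
Qed.

Let Uw_le u : Uw u <= Th ^+ size u.
Proof.
rewrite /Uw; elim: u => [|i u IH]; rewrite ?big_nil// big_cons exprS ler_pM// ?ltW//.
by apply: prodr_gt0.
Qed.

Let Uw_le1 u : Uw u <= 1.
Proof.
by apply: (le_trans (Uw_le u)); rewrite exprn_ile1// ltW; case/andP: Th01.
Qed.

Let wt_le u : wt u <= Lw u `^ t.
Proof.
rewrite /Lw prod_powR; last by move=> i; exact: ltW.
rewrite /wt /weight; elim: u => [|i u IH]; first by rewrite !big_nil.
rewrite !big_cons ler_pM ?letter_mass_ge0 ?prodr_ge0//; first by move=> *; exact: letter_mass_ge0.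
by rewrite /letter_mass ler_pdivrMr// ler_peMr// powR_ge0.
Qed.

Let Uw_powR_le u : Uw u `^ (1 + e) <= Lw u.
Proof.
rewrite /Uw prod_powR; last by move=> i; exact: ltW.
rewrite /Lw; elim: u => [|i u IH]; first by rewrite !big_nil.
by rewrite !big_cons ler_pM ?powR_ge0 ?prodr_ge0// => j _; exact: powR_ge0.
Qed.

Section Discretization.
Variables (phi : R -> R) (x0 : R) (n0 : nat) (mK : R).
Hypothesis phi_nd : forall x y, x <= y -> phi x <= phi y.
Hypothesis phi_holder : forall x y, x <= y -> phi y - phi x <= (y - x) `^ s.
Hypothesis n0_large : 1 + 2 * Y / gap <= d * n0%:R.

Definition overlap (r : R) (k k' : nat) (w w' : seq W) : set R :=
  sublevel a b (fun l => (grid x0 r k - grid x0 r k') +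
    (word_map F w l 0 - word_map F w' l 0)) (2 * r).

Lemma overlap_measurable r k k' w w' : measurable (overlap r k k' w w').
Proof.
apply: (@sublevel_measurable _ _ _ _ _ (2 * Y)); first by rewrite mulr_ge0.
move=> l m lab mab.
have h1 := word_map_lip dba (ltW d0) F_pm w Y0 lab mab.
have h2 := word_map_lip dba (ltW d0) F_pm w' Y0 lab mab.
rewrite [X in `|X|](_ : _ = (word_map F w l 0 - word_map F w m 0) -
  (word_map F w' l 0 - word_map F w' m 0)); last by ring.
by rewrite (le_trans (ler_normB _ _))//; lra.
Qed.

Definition overlap_measure (r : R) (k k' : nat) (w w' : seq W) : R :=
  fine (lebesgue_measure (overlap r k k' w w')).

Lemma overlap_measureE r k k' w w' :
  lebesgue_measure (overlap r k k' w w') = (overlap_measure r k k' w w')%:E.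
Proof.
rewrite fineK// ge0_fin_numE//.
by apply: le_lt_trans (sublevel_le _ _ _ _) _; rewrite ltry.
Qed.

Definition pair_energy (r : R) (n : nat) (w w' : seq W) : R :=
  \sum_(k <- iota 0 n) \sum_(k' <- iota 0 n)
    grid_mass phi x0 r k * grid_mass phi x0 r k' * overlap_measure r k k' w w'.

Let C7 : 0 <= 7 `^ s * (16 / gap + 1).
Proof. by rewrite mulr_ge0 ?powR_ge0// addr_ge0// divr_ge0// ltW. Qed.

Let Th_sigma := Th `^ (s - (1 + e) * (1 - t)).

(** A pair of grid points contributes only if its distance is at most [2 * r] plus
    the size of the cylinder of [u]. *)
Let pair_energy_le u v v' r n V : 0 < r ->
  0 <= V <= 1 -> V <= 16 * r / (gap * Lw u) \/ Uw u < r ->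
  phi (grid x0 r n) - phi x0 <= mK ->
  (forall k k', overlap_measure r k k' (u ++ v) (u ++ v') <= V) ->
  wt u * pair_energy r n (u ++ v) (u ++ v') <=
   mK * (7 `^ s * (16 / gap + 1) * r * Th_sigma ^+ size u).
Proof.
move=> r0 V01 VU nK HV.
have mK0 : 0 <= mK.
  by apply: le_trans nK; rewrite subr_ge0 phi_nd// /grid lerDl mulr_ge0// ltW.
have D0 : 0 <= 2 * r + Uw u by rewrite addr_ge0 ?mulr_ge0 ?ltW// (lt_le_trans (Lw_gt0 u)).
have wt0 : 0 <= wt u by apply: weight_ge0; exact: letter_mass_ge0.
apply: (@le_trans _ _ (wt u * (V * mK * (2 * (2 * r + Uw u) + r) `^ s))).
  rewrite ler_wpM2l//.
  have V0 : 0 <= V by case/andP: V01.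
  apply: (@le_trans _ _ (V * (phi (grid x0 r n) - phi x0) * (2 * (2 * r + Uw u) + r) `^ s)).
    apply: (@sum_grid_mass_pairs _ phi s x0 r phi_nd phi_holder r0 n
      (fun k k' => overlap_measure r k k' (u ++ v) (u ++ v')) V (2 * r + Uw u)) => //.
    move=> k k' kk'; rewrite /overlap_measure.
    suff -> : overlap r k k' (u ++ v) (u ++ v') = set0 by rewrite measure0.
    apply/seteqP; split=> // l [lab]; rewrite !word_map_cat; apply/negP.
    have z0 : 0 <= (0 : R) <= 1 by rewrite lexx ler01.
    have st w := pm_stable (word_map_pm dba (ltW d0) F_pm w) lab z0.
    have /andP[_ h] := word_map_ratio dba (ltW d0) F_pm u (fun i => ltW (lo0 i))
      (fun i => ltW (hi0 i)) F_ratio lab (st v) (st v').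
    have h' : `|word_map F u l (word_map F v l 0) - word_map F u l (word_map F v' l 0)| <= Uw u.
      apply: (le_trans h); rewrite -/(Uw u) ler_piMr//.
        by rewrite ltW// (lt_le_trans (Lw_gt0 u)).
      by have /andP[? ?] := st v; have /andP[? ?] := st v'; rewrite ler_norml; apply/andP; split; lra.
    set G := grid _ _ k - _ in kk' *; set H := word_map F u _ _ - _ in h' *.
    have h2 := ler_normB (G + H) H; rewrite addrK in h2.
    by rewrite -ltNge; lra.
  by rewrite ler_wpM2r ?powR_ge0// ler_wpM2l//; case/andP: V01.
rewrite [leLHS](_ : _ = mK * (wt u * (V * (2 * (2 * r + Uw u) + r) `^ s))); last by ring.
rewrite ler_wpM2l//; apply: le_trans (energy_exponents s01 t01 e0 gap0 (Lw_gt0 u) (Lw_le_Uw u)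
  (Uw_le1 u) (Uw_powR_le u) r0 _ V01 VU) _; first by rewrite wt0 wt_le.
have c0 : 0 <= 7 `^ s * (16 / gap + 1) * r by rewrite mulr_ge0 ?C7// ltW.
apply: (ler_wpM2l c0); apply: (@le_trans _ _ ((Th ^+ size u) `^ (s - (1 + e) * (1 - t)))).
  apply: ge0_ler_powR; rewrite ?nnegrE ?(ltW sigma0)//.
    by rewrite ltW// (lt_le_trans (Lw_gt0 u)).
  by rewrite exprn_ge0// ltW//; case/andP: Th01.
by rewrite -!powR_mulrn ?powR_ge0 -?powRrM ?(mulrC _%:R)//; rewrite ltW//; case/andP: Th01.
Qed.

Let Cenergy := mK * (7 `^ s * (16 / gap + 1)) / (1 - Th_sigma).

(** Each level of the tree contributes [r] times a term of one geometric series,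
    so the bound depends neither on the depth [N] nor on the grid. *)
Lemma total_energy_le r n N u : 0 < r -> Th ^+ (size u + N) < r -> (n0 <= size u)%N ->
  phi (grid x0 r n) - phi x0 <= mK ->
  wt u * (\sum_(v <- words N) \sum_(v' <- words N) wt v * wt v' *
     pair_energy r n (u ++ v) (u ++ v')) <= Cenergy * r.
Proof.
move=> r0 ThN un0 nK.
have mK0 : 0 <= mK.
  by apply: le_trans nK; rewrite subr_ge0 phi_nd// /grid lerDl mulr_ge0// ltW.
have q01 : 0 <= Th_sigma < 1.
  rewrite powR_ge0/= /Th_sigma; case/andP: Th01 => Th0 Th1.
  rewrite /powR gt_eqF// -[ltRHS]expR0 ltr_expR pmulr_rlt0//; apply: ln_lt0.
  by rewrite Th0.
set B := fun k : nat => mK * (7 `^ s * (16 / gap + 1) * r * Th_sigma ^+ k).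
have B0 k : 0 <= B k.
  rewrite /B mulr_ge0// mulr_ge0//; first by rewrite mulr_ge0 ?C7// ltW.
  by rewrite exprn_ge0//; case/andP: q01.
have le1 k k' w w' : overlap_measure r k k' w w' <= 1.
  rewrite -lee_fin -overlap_measureE (le_trans (sublevel_le _ _ _ _))// lee_fin.
  by rewrite ger0_norm// subr_ge0.
apply: (@le_trans _ _ (\sum_(k <- iota 0 N.+1) B (size u + k)%N)).
  apply: (@tree_energy_le _ _ _ letter_mass_ge0 sum_letter_mass _ B n0 (size u + N)) => //.
    move=> u' i j v v' u'n0 ij.
    pose V := Num.min 1 (16 * r / (gap * Lw u')).
    have rL : 0 <= 16 * r / (gap * Lw u').
      by rewrite divr_ge0 ?mulr_ge0// ltW.
    apply: (@pair_energy_le _ _ _ _ _ V) => //.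
    - by rewrite /V le_min ler01 rL ge_min lexx.
    - by left; rewrite /V ge_min lexx orbT.
    - move=> k k'; rewrite /V le_min le1 -lee_fin -overlap_measureE.
      have K0 : 0 < gap * Lw u' / 2 by rewrite divr_gt0 ?mulr_gt0.
      apply: le_trans (@sublevel_le_transversal _ a b _ (2 * r) _ K0 _ _) _.
      + by rewrite mulr_ge0// ltW.
      + move=> l m lab mab; rewrite [X in _ <= `|X|](_ : _ =
         (word_map F (u' ++ i :: v) l 0 - word_map F (u' ++ j :: v') l 0) -
         (word_map F (u' ++ i :: v) m 0 - word_map F (u' ++ j :: v') m 0)); last by ring.
        apply: (word_map_transversal dba (ltW d0) F_pm v v' Y0 gap0 ba1 _ F_gap _ _ ij lab mab).
        * by apply: (le_trans n0_large); rewrite ler_wpM2l ?(ltW d0)// ler_nat.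
        * exact: ltW.
        * move=> l' x y l'ab x01 y01.
          by have /andP[] := word_map_ratio dba (ltW d0) F_pm u' (fun i => ltW (lo0 i))
            (fun i => ltW (hi0 i)) F_ratio l'ab x01 y01.
      + rewrite lee_fin le_eqVlt; apply/orP; left; apply/eqP.
        by field; rewrite !gt_eqF.
  move=> u' u'N; rewrite -[X in pair_energy _ _ X _]cats0 -[X in pair_energy _ _ _ X]cats0.
  apply: (@pair_energy_le _ _ _ _ _ 1) => //; first by rewrite ler01 lexx.
  by right; apply: le_lt_trans (Uw_le _) _; rewrite u'N.
rewrite /B -!mulr_sumr.
have Sle : \sum_(k <- iota 0 N.+1) Th_sigma ^+ (size u + k) <= (1 - Th_sigma)^-1.
  apply: (@le_trans _ _ (\sum_(k <- iota 0 N.+1) Th_sigma ^+ k)).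
    apply: ler_sum => k _; rewrite exprD ler_piMl ?exprn_ge0//; first by case/andP: q01.
    by rewrite exprn_ile1//; [case/andP: q01|rewrite ltW//; case/andP: q01].
  rewrite -[leRHS]mul1r ler_pdivlMr ?subr_gt0//; last by case/andP: q01.
  have := subrXX 1 Th_sigma N.+1; rewrite expr1n => /esym.
  under eq_bigr do rewrite expr1n mul1r.
  rewrite mulrC -(big_mkord predT) /index_iota subn0 /= => ->.
  by rewrite gerBl exprn_ge0//; case/andP: q01.
rewrite /Cenergy [leRHS](_ : _ = mK * (7 `^ s * (16 / gap + 1) * r * (1 - Th_sigma)^-1)); last by ring.
by rewrite ler_wpM2l// ler_wpM2l// mulr_ge0 ?C7// ltW.
Qed.

End Discretization.

Variables (K : set R) (M kK : R) (C : R -> set R).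
Hypothesis K_compact : compact K.
Hypothesis KM : K `<=` `[-M, M].
Hypothesis M0 : 0 <= M.
Hypothesis kK0 : 0 < kK.
Hypothesis K_content : forall p, interval_cover K p -> kK <= cover_cost s p.
Hypothesis C_compact : forall l, a <= l <= b -> compact (C l).
Hypothesis C_nonempty : forall l, a <= l <= b -> C l !=set0.
Hypothesis C01 : forall l x, a <= l <= b -> C l x -> 0 <= x <= 1.
Hypothesis F_C : forall i l x, a <= l <= b -> C l x -> C l (F i l x).

Let phi := content_upto K s.

Let wt_ge0 v : 0 <= wt v.
Proof. by apply: weight_ge0 => i; exact: letter_mass_ge0. Qed.

Lemma word_map_C w l x : a <= l <= b -> C l x -> C l (word_map F w l x).
Proof. by move=> lab Cx; elim: w => //= i w IH; exact: F_C. Qed.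

Lemma word_map_contraction w l x y : a <= l <= b -> 0 <= x <= 1 -> 0 <= y <= 1 ->
  `|word_map F w l x - word_map F w l y| <= Th ^+ size w.
Proof.
move=> lab x01 y01.
have /andP[_ h] := word_map_ratio dba (ltW d0) F_pm w (fun i => ltW (lo0 i))
  (fun i => ltW (hi0 i)) F_ratio lab x01 y01.
apply: (le_trans h); apply: le_trans (Uw_le w); apply: ler_piMr.
  exact: ltW (lt_le_trans (Lw_gt0 w) (Lw_le_Uw w)).
by move: x01 y01 => /andP[? ?] /andP[? ?]; rewrite ler_norml; apply/andP; split; lra.
Qed.

(** The weighted points [grid k + F_(u0 ++ v) 0] approximate [K + C_l]; all the
    codes start with the long word [u0] so that transversality applies to every
    pair, and [v] is long enough for its cylinder to be shorter than the mesh. *)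
Lemma sumset_measure_gt0_ae : {ae mu, forall l, a <= l <= b ->
  (0 < mu [set (x + y)%R | x in K & y in C l])%E}.
Proof.
have [Th0 Th1] : 0 < Th /\ Th < 1 by case/andP: Th01.
have nat_gt (z : R) : exists k : nat, z < k%:R.
  by exists (Num.truncn z).+1; exact: Num.Theory.truncnS_gt.
have [T T_large] := nat_gt (2 * M + 2); pose x0 : R := - (M + 1).
have [n0 n0_gt] := nat_gt ((1 + 2 * Y / gap) / d).
have n0_large : 1 + 2 * Y / gap <= d * n0%:R.
  by rewrite [leRHS]mulrC -ler_pdivrMr// ltW.
have [i0 _] : exists i : W, true.
  apply: contrapT => noW; move: lo_t; rewrite big1 ?leNgt ?ltr01// => i _.
  by exfalso; apply: noW; exists i.
pose u0 := nseq n0 i0.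
pose r (j : nat) : R := j.+1%:R^-1.
have r0 j : 0 < r j by rewrite invr_gt0.
pose n j := (j.+1 * T)%N.
have grid_n j : grid x0 (r j) (n j) = x0 + T%:R.
  by rewrite /grid /n natrM mulrAC divff ?mul1r// pnatr_eq0.
have xN j : {N | Th ^+ N < r j}.
  apply: cid; have [|N] := @exp_lt_eps _ Th 1 (r j) _ (r0 j); first by rewrite ltW.
  by rewrite mul1r; exists N.
pose N j := sval (xN j).
have ThN j : Th ^+ N j < r j by exact: (svalP (xN j)).
pose m := phi (x0 + T%:R) - phi x0.
have m_ge : kK <= m.
  apply: (content_upto_mass KM M0) => //; first by rewrite /x0; lra.
  by rewrite /x0; lra.
have phi_nd := content_upto_nondecreasing s KM M0.
have phi_holder := content_upto_holder s KM M0.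
pose gm j := grid_mass phi x0 (r j).
have gm0 j k : 0 <= gm j k by exact: grid_mass_ge0.
pose pts j : seq (nat * seq W) := [seq (k, v) | k <- iota 0 (n j), v <- words (N j)].
pose om j (p : nat * seq W) := gm j p.1 * wt p.2.
have om0 j p : 0 <= om j p by rewrite mulr_ge0.
pose y j (l : R) (p : nat * seq W) := grid x0 (r j) p.1 + word_map F (u0 ++ p.2) l 0.
pose prs j := [seq (p, p') | p <- pts j, p' <- pts j].
pose c j (pp : (nat * seq W) * (nat * seq W)) := om j pp.1 * om j pp.2 / r j.
pose S j (pp : (nat * seq W) * (nat * seq W)) :=
  overlap x0 (r j) pp.1.1 pp.2.1 (u0 ++ pp.1.2) (u0 ++ pp.2.2).
have c0 j pp : 0 <= c j pp by rewrite divr_ge0 ?mulr_ge0 ?om0// ltW.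
have mS j pp : measurable (S j pp).
  exact: overlap_measurable.
pose E j := step_sum (prs j) (c j) (S j).
have om_sum j : \sum_(p <- pts j) om j p = m.
  rewrite /pts big_allpairs/= /om/=.
  under eq_bigr do rewrite -mulr_sumr (sum_weight sum_letter_mass) mulr1.
  by rewrite /m -(grid_n j) -sum_grid_mass.
have EE j l : a <= l <= b -> E j l = (\sum_(p <- pts j) \sum_(p' <- pts j)
    om j p * om j p' * (`|y j l p - y j l p'| <= 2 * r j)%R%:R) / r j.
  move=> lab; rewrite /E /step_sum big_allpairs mulr_suml; apply: eq_bigr => p _.
  rewrite mulr_suml; apply: eq_bigr => p' _; rewrite /c /= mulrAC; congr (_ * _ / _).
  rewrite indicE; congr (_%:R); congr nat_of_bool; apply/idP/idP.
    rewrite inE => -[_]; rewrite /y; apply: le_trans; rewrite le_eqVlt.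
    by apply/orP; left; apply/eqP; congr (`|_|); ring.
  move=> yy; rewrite inE; split=> //; apply: le_trans yy; rewrite le_eqVlt.
  by apply/orP; left; apply/eqP; congr (`|_|); rewrite /y; ring.
set Cen := m * (7 `^ s * (16 / gap + 1)) / (1 - Th `^ (s - (1 + e) * (1 - t))).
have wu0 : 0 < wt u0.
  apply: prodr_gt0 => i _; exact: divr_gt0 (powR_gt0 _ (lo0 i)) S0.
have intE j : (\int[mu]_(l in `[a, b]) (E j l)%:E <= (Cen / wt u0)%:E)%E.
  rewrite (integral_step_sum mu (prs j) (c0 j) (mS j))//.
  apply: (@le_trans _ _ (\sum_(p <- pts j) \sum_(p' <- pts j)
      c j (p, p') * overlap_measure x0 (r j) p.1 p'.1 (u0 ++ p.2) (u0 ++ p'.2))%:E).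
    rewrite big_allpairs -sumEFin; apply: lee_sum => p _.
    rewrite -sumEFin; apply: lee_sum => p' _; rewrite (EFinM (c j (p, p'))) lee_wpmul2l ?lee_fin//.
    by rewrite -overlap_measureE//; apply: le_outer_measure; exact: subIsetl.
  rewrite lee_fin ler_pdivlMr// mulrC.
  have := @total_energy_le phi x0 n0 m phi_nd phi_holder n0_large (r j) (n j) (N j) u0 (r0 j).
  rewrite size_nseq grid_n -/wt -/Cen lexx leqnn => /(_ _ isT isT).
  have ThnN : Th ^+ (n0 + N j) < r j.
    apply: le_lt_trans (ThN j); rewrite exprD ler_piMl ?exprn_ge0 ?exprn_ile1//; exact: ltW.
  move=> /(_ ThnN) H.
  rewrite -(ler_pM2r (r0 j)); apply: le_trans H; rewrite -mulrA ler_pM2l//.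
  rewrite le_eqVlt; apply/orP; left; apply/eqP.
  rewrite mulr_suml /pts big_allpairs /=.
  under eq_bigr => k _ do under eq_bigr => v _ do rewrite mulr_suml big_allpairs /=.
  rewrite exchange_big/=; apply: eq_bigr => v _.
  under eq_bigr => k _ do rewrite exchange_big/=.
  rewrite exchange_big/=; apply: eq_bigr => v' _.
  rewrite /pair_energy mulr_sumr; apply: eq_bigr => k _.
  rewrite mulr_sumr; apply: eq_bigr => k' _.
  by rewrite /c /om /= -/(gm j k) -/(gm j k'); field; rewrite gt_eqF.
have := @frequently_bounded_ae R `[a, b] E (Cen / wt u0) (measurable_itv _)
  (fun j => measurable_step_sum _ _ (mS j) (D := _)) (fun j => step_sum_ge0 _ _ (c0 j)) intE.
apply: (@filterS _ (almost_everywhere mu) (ae_filter_ringOfSetsType mu)) => l H lab.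
have [|B B0 HB] := H _; first by rewrite /= in_itv.
set SS := [set _ | _ in _ & _ in _].
have SSc : compact SS by apply: sumset_compact => //; exact: C_compact.
have m0 : 0 < m by exact: lt_le_trans m_ge.
apply: (@neighborhood_measure_gt0 R SS (2 * m ^+ 2 / B) SSc).
  by rewrite divr_gt0// mulr_gt0// exprn_gt0.
move=> rr rr0.
have [N0 N0r] := nat_gt (3 / rr); have [j Nj Ej] := HB N0.
have rj : 3 * r j <= rr.
  rewrite /r ler_pdivrMr// mulrC -ler_pdivrMr// ltW// (lt_le_trans N0r)//.
  by rewrite ler_nat ltnW.
(* One mesh for the grid, one for the truncation of the code and one for the
   intervals that carry the masses. *)
exists (3 * r j) => //.
rewrite -(om_sum j); apply: (@mass_energy R _ (pts j) (om j) (y j l) (r j)) => //.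
- by rewrite om_sum.
- by apply: compact_measurable; exact: neighborhood_compact.
- move=> p /allpairsP[[k v] /= [_ vN ->]]; rewrite /om /= => kv0.
  have gk : 0 < gm j k.
    by rewrite lt_def gm0 andbT; apply/eqP => g0; move: kv0; rewrite g0 mul0r ltxx.
  have [z Kz] : exists2 z, K z & grid x0 (r j) k < z <= grid x0 (r j) k.+1.
    apply: (content_upto_support KM M0); rewrite -subr_gt0; exact: gk.
  rewrite (_ : grid x0 (r j) k.+1 = grid x0 (r j) k + r j); last first.
    by rewrite /grid -natr1 mulrDl mul1r addrA.
  move=> /andP[kz zk] x; rewrite /= in_itv/= /y /= => /andP[x1 x2].
  have [cc Ccc] := C_nonempty lab.
  have c01 := C01 lab Ccc.
  have z01 : 0 <= (0 : R) <= 1 by rewrite lexx ler01.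
  have := word_map_contraction (u0 ++ v) lab z01 c01.
  set f0 := word_map F _ l 0 in x1 x2 *; set f1 := word_map F _ l cc => f01.
  have f01r : `|f0 - f1| <= r j.
    apply: (le_trans f01); rewrite size_cat; move: vN; rewrite mem_words => /eqP ->.
    apply: ltW; apply: le_lt_trans (ThN j); rewrite exprD ler_piMl ?exprn_ge0 ?exprn_ile1//; exact: ltW.
  exists (z + f1); first by exists z => //; exists f1 => //; exact: word_map_C.
  move: f01r; rewrite !ler_norml => /andP[? ?]; apply/andP; split; lra.
- by move: Ej; rewrite EE// ler_pdivrMr.
Qed.

End BlockSystem.

(** * Blocks of letters *)
Section Dimension.
Context {R : realType} {W : finType}.
Variables (f : W -> R -> R) (hi : W -> R) (C : set R) (t k : R).
Hypothesis hi0 : forall i, 0 <= hi i.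
Hypothesis f_stable : forall i x, 0 <= x <= 1 -> 0 <= f i x <= 1.
Hypothesis f_hi : forall i x y, 0 <= x <= 1 -> 0 <= y <= 1 ->
  `|f i x - f i y| <= hi i * `|x - y|.
Hypothesis C01 : forall x, C x -> 0 <= x <= 1.
Hypothesis C_cover : forall x, C x -> exists i, exists2 y, C y & f i y = x.
Hypothesis k0 : 0 < k.
Hypothesis C_content : forall p, interval_cover C p -> k <= cover_cost t p.

Let fw (w : seq W) (x : R) : R := foldr f x w.

(** If the sum were less than one, covers by cylinders would be too cheap: covering [C]
    by its cylinders of order [N] costs [2 `^ t * (sum_i hi i `^ t) ^+ N]. *)
Lemma sum_ratio_ge1 : 1 <= \sum_i hi i `^ t.
Proof.
rewrite leNgt; apply/negP => S1; set S := \sum_i _ in S1.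
have S01 : 0 <= S < 1 by rewrite S1 andbT; apply: sumr_ge0 => i _; exact: powR_ge0.
have [N HN] := exp_lt_eps (2 `^ t) S01 k0.
pose U w := \prod_(i <- w) hi i.
have U0 w : 0 <= U w by apply: prodr_ge0.
pose l := [seq (fw w 0 - U w, fw w 0 + U w) | w <- words N].
have st w x : 0 <= x <= 1 -> 0 <= fw w x <= 1.
  by move=> x01; elim: w => //= i w IH; exact: f_stable.
have fU w x y : 0 <= x <= 1 -> 0 <= y <= 1 -> `|fw w x - fw w y| <= U w.
  move=> x01 y01; elim: w => [|i w IH].
    rewrite /U big_nil /= ler_norml.
    by move: x01 y01 => /andP[? ?] /andP[? ?]; apply/andP; split; lra.
  rewrite /U big_cons /=; apply: le_trans (f_hi _ (st w x x01) (st w y y01)) _.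
  by rewrite ler_wpM2l.
have cov n x : C x -> exists2 w, w \in words n & exists2 y, C y & fw w y = x.
  elim: n x => [|n IH] x Cx; first by exists [::] => //; exists x.
  have [i [y Cy yx]] := C_cover Cx; have [w wn [z Cz zy]] := IH y Cy.
  exists (i :: w); first by move: wn; rewrite !mem_words.
  by exists z => //=; rewrite zy.
have /C_content : interval_cover C l.
  split=> [p /mapP[w _ ->]|x Cx] /=; first by have := U0 w; lra.
  have [w wN [y Cy <-]] := cov N x Cx.
  exists (fw w 0 - U w, fw w 0 + U w) => /=; first by apply/mapP; exists w.
  rewrite -ler_distl; apply: fU; first exact: C01.
  by rewrite lexx ler01.
rewrite leNgt => /negP; apply; apply: le_lt_trans HN.
rewrite /cover_cost big_map -sum_words_prod mulr_sumr le_eqVlt; apply/orP; left; apply/eqP.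
apply: eq_bigr => w _; rewrite -prod_powR// -/(U w) -powRM//=.
by congr (_ `^ _); ring.
Qed.

End Dimension.

Section Restriction.
Context {R : realType}.
Variables (a b a' b' : R).
Hypotheses (aa' : a <= a') (bb' : b' <= b).

Let sub l : a' <= l <= b' -> a <= l <= b.
Proof. by move=> /andP[? ?]; rewrite (le_trans aa')// (le_trans _ bb'). Qed.

Lemma parametrized_mapS Y d n f : parametrized_map a b Y d n f ->
  parametrized_map a' b' Y d n f.
Proof.
move=> [fs fi fc fd]; split.
- by move=> l x /sub; exact: fs.
- by move=> l x y /sub; exact: fi.
- by move=> l m x y /sub lab /sub; exact: fc.
- by move=> l m x y x' y' /sub lab /sub; exact: fd.
Qed.

Lemma ratio_betweenS lo hi f : @ratio_between R a b lo hi f -> ratio_between a' b' lo hi f.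
Proof. by move=> H l x y /sub; exact: H. Qed.

Lemma distortion_leS Q N S f : @distortion_le R a b Q N S f -> distortion_le a' b' Q N S f.
Proof. by move=> H l m x y x' y' /sub lab /sub; exact: H. Qed.

End Restriction.

Section Blocks.
Context {R : realType} {I : finType}.
Local Notation mu := (@lebesgue_measure R).
Variables (a b l0 Y d lo th Q gap : R) (F : I -> R -> R -> R).
Hypothesis ba1 : b - a <= 1.
Hypothesis l0ab : a <= l0 <= b.
Hypothesis dba : d * (b - a) <= 1.
Hypothesis d0 : 0 < d.
Hypothesis Y0 : 0 <= Y.
Hypothesis Q0 : 0 <= Q.
Hypothesis F_pm : forall i, parametrized_map a b Y d 1 (F i).
Hypothesis F_ratio : forall i, ratio_between a b lo th (F i).
Hypothesis lo01 : 0 < lo <= 1.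
Hypothesis th01 : 0 < th < 1.
Hypothesis F_dist : forall i, distortion_le a b Q 1 1 (F i).
Hypothesis gap0 : 0 < gap.
Hypothesis F_gap : forall i j l x y, i != j -> a <= l <= b ->
  0 <= x <= 1 -> 0 <= y <= 1 -> gap <= `|F i l x - F j l y|.

Let z01 : 0 <= (0 : R) <= 1. Proof. by rewrite lexx ler01. Qed.
Let o01 : 0 <= (1 : R) <= 1. Proof. by rewrite lexx ler01. Qed.

Let th0 : 0 < th. Proof. by case/andP: th01. Qed.
Let th1 : th < 1. Proof. by case/andP: th01. Qed.
Let lo0 : 0 < lo. Proof. by case/andP: lo01. Qed.

Lemma word_map_ratio_exp w :
  ratio_between a b (lo ^+ size w) (th ^+ size w) (word_map F w).
Proof.
have prodc x : \prod_(i <- w) x = x ^+ size w :> R.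
  by rewrite big_const_seq count_predT iter_mulr_1.
rewrite -!prodc; apply: (word_map_ratio dba (ltW d0)) => // _; exact: ltW.
Qed.

(** The distances of the end points form a geometric series along the word; only
    the parameter contributes an exponent that grows with the length. *)
Lemma word_map_distortion w :
  distortion_le a b Q ((size w)%:R * (1 + 2 * Y)) (1 - th)^-1 (word_map F w).
Proof.
suff H : distortion_le a b Q ((size w)%:R * (1 + 2 * Y))
    (\sum_(k < size w) th ^+ k) (word_map F w).
  move=> l m x y x' y' lab mab x01 y01 x'01 y'01.
  apply: le_trans (H l m x y x' y' lab mab x01 y01 x'01 y'01) _.
  rewrite ler_wpM2r ?mulr_ge0// ler_expR ler_wpM2l// lerD2l ler_wpM2r ?addr_ge0//.
  rewrite -[leRHS]mul1r ler_pdivlMr ?subr_gt0//.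
  have := subrXX 1 th (size w); rewrite expr1n => /esym.
  under eq_bigr do rewrite expr1n mul1r.
  by rewrite mulrC => ->; rewrite gerBl exprn_ge0// ltW.
elim: w => [|i w IH].
  by move=> l m x y x' y' *; rewrite big_ord0 mul0r !mul0r addr0 mulr0 expR0 mul1r mulrC.
rewrite /= -natr1 mulrDl mul1r big_ord_recr/=.
apply: (distortion_le_comp Q0 Y0 (F_pm i) (F_dist i) (word_map_pm dba (ltW d0) F_pm w) IH).
move=> l x y lab x01 y01; rewrite mul0r normr_ge0/=.
by have /andP[] := word_map_ratio_exp w lab x01 y01.
Qed.

Section Choice.
Variables (e et : R) (n : nat).
Hypothesis e0 : 0 < e.
Hypothesis n0 : (0 < n)%N.
Hypothesis l_et : forall l, a <= l <= b -> `|l - l0| <= et.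

(** All the chords of a block are compared with its longest chord at [l0]. *)
Let M (w : n.-tuple I) : R := `|word_map F w l0 0 - word_map F w l0 1|.
Let qn : R := Q * (n%:R * (1 + 2 * Y) * et + (1 - th)^-1 * 2).

(** [et] small and [n] large make the distortion of the words of length [n]
    negligible compared with their contraction. *)
Hypothesis small_distortion : (2 + e) * qn <= - (n%:R * e * ln th).

Let blo (w : n.-tuple I) : R := M w * expR (- qn).
Let bhi (w : n.-tuple I) : R := M w * expR qn.

Let M_gt0 w : 0 < M w.
Proof.
have /andP[h _] := word_map_ratio_exp w l0ab z01 o01.
by apply: lt_le_trans h; rewrite sub0r normrN normr1 mulr1 exprn_gt0.
Qed.

Let M_le w : M w <= th ^+ n.
Proof.
have /andP[_] := word_map_ratio_exp w l0ab z01 o01.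
by rewrite sub0r normrN normr1 mulr1 size_tuple.
Qed.

Let lnM_le w : ln (M w) <= n%:R * ln th.
Proof. by rewrite -[leRHS]mulrC mulr_natr -lnXn// ler_ln ?posrE// exprn_gt0. Qed.

Let dist_arg_le l x y : a <= l <= b -> 0 <= x <= 1 -> 0 <= y <= 1 ->
  Q * (n%:R * (1 + 2 * Y) * `|l - l0| + (1 - th)^-1 * (`|x - 0| + `|y - 1|)) <= qn.
Proof.
move=> lab /andP[x0 x1] /andP[y0 y1]; rewrite ler_wpM2l// lerD//.
  by rewrite ler_wpM2l ?l_et// mulr_ge0// addr_ge0// mulr_ge0.
rewrite ler_wpM2l ?invr_ge0 ?subr_ge0 ?(ltW th1)//.
by rewrite subr0 ger0_norm// distrC ger0_norm ?subr_ge0//; lra.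
Qed.

Lemma block_ratio (w : n.-tuple I) : ratio_between a b (blo w) (bhi w) (word_map F w).
Proof.
move=> l x y lab x01 y01; apply/andP; split.
  have := word_map_distortion w l0ab lab z01 o01 x01 y01.
  rewrite -/(M w) (distrC l0) (distrC 0) (distrC 1 y) size_tuple sub0r normrN normr1 mulr1.
  move=> H; rewrite /blo mulrAC expRN ler_pdivrMr ?expR_gt0//.
  apply: (le_trans H); rewrite mulrC ler_wpM2l// ler_expR; exact: dist_arg_le.
have := word_map_distortion w lab l0ab x01 y01 z01 o01.
rewrite -/(M w) size_tuple sub0r normrN normr1 mulr1 => H.
apply: (le_trans H).
rewrite [leRHS](_ : _ = expR qn * (M w * `|x - y|)); last by rewrite /bhi; ring.
have Mxy : 0 <= M w * `|x - y| by rewrite mulr_ge0 ?(ltW (M_gt0 w)).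
by rewrite (ler_wpM2r Mxy)// ler_expR dist_arg_le.
Qed.

Let powRE (x p : R) : 0 < x -> x `^ p = expR (p * ln x).
Proof. by move=> x0; rewrite /powR gt_eqF. Qed.

Let lnbhi w : ln (bhi w) = ln (M w) + qn.
Proof. by rewrite /bhi lnM ?posrE ?expR_gt0// expRK. Qed.

Let lnblo w : ln (blo w) = ln (M w) - qn.
Proof. by rewrite /blo lnM ?posrE ?expR_gt0// expRK. Qed.

Let blo_gt0 w : 0 < blo w. Proof. by rewrite mulr_gt0 ?expR_gt0. Qed.
Let bhi_gt0 w : 0 < bhi w. Proof. by rewrite mulr_gt0 ?expR_gt0. Qed.

Let lnth_lt0 : n%:R * ln th < 0.
Proof. by rewrite pmulr_rlt0 ?ltr0n// ln_lt0// th0. Qed.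

Let block_exponent w : bhi w `^ (1 + e) <= blo w.
Proof.
rewrite -[leRHS]lnK ?posrE// powRE// ler_expR lnbhi lnblo.
have := ler_wpM2l (ltW e0) (lnM_le w); move: small_distortion; lra.
Qed.

Let Th := expR (n%:R * ln th * (2 / (2 + e))).

Let Th01 : 0 < Th < 1.
Proof.
rewrite expR_gt0/= -[ltRHS]expR0 ltr_expR nmulr_rlt0// divr_gt0// addr_gt0//.
Qed.

Let bhi_le w : bhi w <= Th.
Proof.
have e2 : 0 < 2 + e by rewrite addr_gt0.
rewrite -[leLHS]lnK ?posrE// ler_expR lnbhi mulrA ler_pdivlMr//.
have := ler_wpM2r (ltW e2) (lnM_le w); move: small_distortion; lra.
Qed.

Variables (K : set R) (kK kC s t' : R) (C : R -> set R).
Hypothesis K_compact : compact K.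
Hypothesis kK0 : 0 < kK.
Hypothesis kC0 : 0 < kC.
Hypothesis K_content : forall p, interval_cover K p -> kK <= cover_cost s p.
Hypothesis C_content : forall p, interval_cover (C l0) p -> kC <= cover_cost t' p.
Hypothesis C_compact : forall l, a <= l <= b -> compact (C l).
Hypothesis C_nonempty : forall l, a <= l <= b -> C l !=set0.
Hypothesis C01 : forall l x, a <= l <= b -> C l x -> 0 <= x <= 1.
Hypothesis F_C : forall i l x, a <= l <= b -> C l x -> C l (F i l x).
Hypothesis C_F : forall x, C l0 x -> exists i, exists2 y, C l0 y & F i l0 y = x.
Hypothesis s01 : 0 < s <= 1.
Hypothesis t'01 : 0 < t' < 1.
Hypothesis st' : s + t' = 1 + 2 * e.

Lemma blocks_sumset_ae : {ae mu, forall l, a <= l <= b ->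
  (0 < mu [set (x + y)%R | x in K & y in C l])%E}.
Proof.
have ab : a <= b by case/andP: l0ab; exact: le_trans.
have [M0 KM M00] : exists2 M0, K `<=` `[- M0, M0] & 0 <= M0.
  have [N [_ KN]] := compact_bounded K_compact.
  exists (Num.max 0 (N + 1)); last by rewrite le_max lexx.
  have NM : N < Num.max 0 (N + 1) by rewrite lt_max ltrDl ltr01 orbT.
  by move=> x Kx; rewrite /= in_itv/= -ler_norml; exact: KN NM x Kx.
have e10 : 0 < 1 + e by rewrite addr_gt0.
have [t'0 t'1] : 0 < t' /\ t' < 1 by case/andP: t'01.
(* The loss [1 + e] between upper and lower ratios is paid by the exponent. *)
pose t := t' / (1 + e).
have te : (1 + e) * t = t' by rewrite /t mulrC divfK// gt_eqF.
have sum1 : 1 <= \sum_(w : n.-tuple I) blo w `^ t.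
  apply: (@le_trans _ _ (\sum_(w : n.-tuple I) bhi w `^ t')).
  apply: (@sum_ratio_ge1 R (n.-tuple I) (fun w => word_map F w l0) bhi (C l0) t' kC) => //.
  - by move=> w; exact: ltW.
  - by move=> w x; exact: (pm_stable (word_map_pm dba (ltW d0) F_pm w)).
  - by move=> w x y x01 y01; have /andP[] := block_ratio w l0ab x01 y01.
  - by move=> x; exact: C01.
  - suff H k x : C l0 x -> exists w : k.-tuple I, exists2 y, C l0 y & word_map F w l0 y = x.
      by move=> x Cx; exact: (H n).
    elim: k x => [|k IH] x Cx; first by exists [tuple]; exists x.
    have [i [y Cy yx]] := C_F Cx; have [w [z Cz zy]] := IH y Cy.
    by exists [tuple of i :: w]; exists z => //=; rewrite zy.
  - apply: ler_sum => w _; rewrite -te powRrM; apply: ge0_ler_powR.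
    + by rewrite /t divr_ge0// ltW.
    + by rewrite nnegrE powR_ge0.
    + by rewrite nnegrE ltW.
    + exact: block_exponent.
apply: (@sumset_measure_gt0_ae R (n.-tuple I) a b Y d (fun w => word_map F w) blo bhi
  (lo ^+ n * gap) Th s t e _ _ _ _ _ _ _ _ _ _ _ _ _ _ _ _ _ _ K M0 kK C) => //.
- move=> w; apply: (@parametrized_map_weaken _ a b _ _ (size w)) => //.
  + exact: ltW.
  + by rewrite size_tuple.
  + exact: (word_map_pm dba (ltW d0) F_pm).
- exact: block_ratio.
- by rewrite mulr_gt0// exprn_gt0.
- move=> w w' l x y ww' lab x01 y01; rewrite -{1}(size_tuple w).
  apply: (word_map_gap dba (ltW d0) F_pm) => //.
  + by rewrite ltW//; case/andP: lo01.
  + exact: ltW.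
  + by move=> i l' x' y' l'ab x'01 y'01; have /andP[] := F_ratio i l'ab x'01 y'01.
  + by rewrite !size_tuple.
- rewrite /t divr_gt0//= ltr_pdivrMr// mul1r (lt_le_trans t'1)//.
  by rewrite lerDl ltW.
- exact: ltW.
- by rewrite mulrBr te mulr1; move: st' e0; lra.
- by move=> w l x lab Cx; exact: (word_map_C F_C).
Qed.

End Choice.
End Blocks.

Section Letters.
Context {R : realType} {I : finType}.
Local Notation mu := (@lebesgue_measure R).
Variables (a b l0 Y d lo th Q gap : R) (F : I -> R -> R -> R).
Hypothesis ba1 : b - a <= 1.
Hypothesis l0ab : a < l0 < b.
Hypothesis dba : d * (b - a) <= 1.
Hypothesis d0 : 0 < d.
Hypothesis Y0 : 0 <= Y.
Hypothesis Q0 : 0 <= Q.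
Hypothesis F_pm : forall i, parametrized_map a b Y d 1 (F i).
Hypothesis F_ratio : forall i, ratio_between a b lo th (F i).
Hypothesis lo01 : 0 < lo <= 1.
Hypothesis th01 : 0 < th < 1.
Hypothesis F_dist : forall i, distortion_le a b Q 1 1 (F i).
Hypothesis gap0 : 0 < gap.
Hypothesis F_gap : forall i j l x y, i != j -> a <= l <= b ->
  0 <= x <= 1 -> 0 <= y <= 1 -> gap <= `|F i l x - F j l y|.
Variables (K : set R) (kK kC s t' : R) (C : R -> set R).
Hypothesis K_compact : compact K.
Hypothesis kK0 : 0 < kK.
Hypothesis kC0 : 0 < kC.
Hypothesis K_content : forall p, interval_cover K p -> kK <= cover_cost s p.
Hypothesis C_content : forall p, interval_cover (C l0) p -> kC <= cover_cost t' p.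
Hypothesis C_compact : forall l, a <= l <= b -> compact (C l).
Hypothesis C_nonempty : forall l, a <= l <= b -> C l !=set0.
Hypothesis C01 : forall l x, a <= l <= b -> C l x -> 0 <= x <= 1.
Hypothesis F_C : forall i l x, a <= l <= b -> C l x -> C l (F i l x).
Hypothesis C_F : forall x, C l0 x -> exists i, exists2 y, C l0 y & F i l0 y = x.
Hypothesis s01 : 0 < s <= 1.
Hypothesis t'01 : 0 < t' < 1.
Hypothesis st' : 1 < s + t'.

(** The exponent to be spared, [e], is half of the excess of [s + t'] over one. The
    small radius [et] and the large length [n] of the blocks let half of [e] times
    their contraction exponent pay for the part of the distortion that grows with
    [n], and the other half for the bounded part. *)
Lemma letters_sumset_ae : exists a' b', a' < l0 < b' /\
  {ae mu, forall l, a' <= l <= b' -> (0 < mu [set (x + y)%R | x in K & y in C l])%E}.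
Proof.
have [al0 l0b] : a < l0 /\ l0 < b by case/andP: l0ab.
have [th0 th1] : 0 < th /\ th < 1 by case/andP: th01.
pose e := (s + t' - 1) / 2.
have e0 : 0 < e by rewrite /e; move: st'; lra.
pose nl := - ln th.
have nl0 : 0 < nl by rewrite oppr_gt0 ln_lt0// th0.
pose D := (2 + e) * (Q + 1) * (1 + 2 * Y).
have D0 : 0 < D.
  have h1 : 0 < 2 + e by rewrite addr_gt0.
  have h2 : 0 < Q + 1 by rewrite ltr_wpDl.
  have h3 : 0 < 1 + 2 * Y by rewrite ltr_wpDr// mulr_ge0.
  by rewrite /D !mulr_gt0.
pose et := e * nl / 2 / D.
have et0 : 0 < et by rewrite /et !divr_gt0// mulr_gt0.
have [n n0 nl_n] : exists2 n : nat, (0 < n)%N &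
    (2 + e) * (Q * ((1 - th)^-1 * 2)) / (e * nl / 2) <= n%:R.
  exists (Num.truncn ((2 + e) * (Q * ((1 - th)^-1 * 2)) / (e * nl / 2))).+1 => //.
  by apply: ltW; exact: Num.Theory.truncnS_gt.
pose a' := Num.max a (l0 - et); pose b' := Num.min b (l0 + et).
have aa' : a <= a' by rewrite le_max lexx.
have bb' : b' <= b by rewrite ge_min lexx.
have l0ab' : a' < l0 < b'.
  by rewrite gt_max al0 gtrBl et0 /= lt_min l0b ltrDl et0.
have sub l : a' <= l <= b' -> a <= l <= b.
  by move=> /andP[h1 h2]; rewrite (le_trans aa')//= (le_trans h2).
have ba' : b' - a' <= b - a by rewrite lerB.
exists a', b'; split=> //.
apply: (@blocks_sumset_ae R I a' b' l0 Y d lo th Q gap F _ _ _ d0 Y0 Q0 _ _ lo01 th01 _ gap0 _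
  e et n e0 n0 _ _ K kK kC s t' C) => //.
- exact: le_trans ba1.
- by move: l0ab' => /andP[? ?]; apply/andP; split; exact: ltW.
- by apply: le_trans dba; rewrite ler_wpM2l// ltW.
- by move=> i; exact: parametrized_mapS (F_pm i).
- by move=> i; exact: ratio_betweenS (F_ratio i).
- by move=> i; exact: distortion_leS (F_dist i).
- by move=> i j l x y ij /sub; exact: F_gap.
- move=> l /andP[]; rewrite ge_max le_min => /andP[_ h1] /andP[_ h2].
  by rewrite ler_norml; apply/andP; split; lra.
- rewrite [leRHS](_ : _ = n%:R * (e * nl)); last by rewrite /nl; ring.
  have h1 : (2 + e) * (Q * (n%:R * (1 + 2 * Y) * et)) <= n%:R * (e * nl / 2).
    rewrite (_ : e * nl / 2 = D * et); last by rewrite /et [RHS]mulrC divfK// gt_eqF.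
    rewrite [leLHS](_ : _ = n%:R * ((2 + e) * Q * (1 + 2 * Y) * et)); last by ring.
    apply: ler_wpM2l => //; apply: ler_wpM2r; first exact: ltW.
    apply: ler_wpM2r; first by rewrite addr_ge0// mulr_ge0.
    by apply: ler_wpM2l; [rewrite addr_ge0// ltW|rewrite lerDl].
  have h2 : (2 + e) * (Q * ((1 - th)^-1 * 2)) <= n%:R * (e * nl / 2).
    by rewrite -ler_pdivrMr// divr_gt0// mulr_gt0.
  by lra.
- by move=> l /sub; exact: C_compact.
- by move=> l /sub; exact: C_nonempty.
- by move=> l x /sub; exact: C01.
- by move=> i l x /sub; exact: F_C.
- by rewrite /e; lra.
Qed.

End Letters.

(** * Dynamically defined Cantor sets *)
Section FinitelyMany.
Context {R : realType} {T : finType}.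

Lemma finitely_many_pos (P : T -> R -> Prop) :
  (forall i, exists2 e, 0 < e & P i e) ->
  (forall i e e', 0 < e' -> e' <= e -> P i e -> P i e') ->
  exists2 e, 0 < e & forall i, P i e.
Proof.
move=> H mono.
suff [e e0 He] : exists2 e, 0 < e & forall i, i \in enum T -> P i e.
  by exists e => // i; apply: He; rewrite mem_enum.
elim: (enum T) => [|i s [e e0 IH]]; first by exists 1.
have [e' e'0 He'] := H i; have m0 : 0 < Num.min e e' by rewrite lt_min e0.
exists (Num.min e e') => // j; rewrite inE => /orP[/eqP ->|js].
  by apply: mono He' => //; rewrite ge_min lexx orbT.
by apply: mono (IH j js) => //; rewrite ge_min lexx.
Qed.

End FinitelyMany.

Section CantorSet.
Context {R : realType} {m : nat}.
Variables (f : 'I_m -> R -> R) (C : set R).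
Hypothesis fC : generates_cantor_set f C.

Let CE : C = \bigcap_(n in [set: nat]) cantor_stage f n.
Proof. by case: fC. Qed.

Let f_disj : trivIset [set: 'I_m] (fun i => f i @` `[0, 1]).
Proof. by case: fC. Qed.

Lemma cantor_map_stable i x : 0 <= x <= 1 -> 0 <= f i x <= 1.
Proof.
case: fC => /(_ i)[fs _ _] _ _ x01; have := fs x.
by rewrite /= !in_itv/=; exact.
Qed.

Let f_lip i x y : 0 <= x <= 1 -> 0 <= y <= 1 -> `|f i x - f i y| <= `|x - y|.
Proof.
case: fC => /(_ i)[_ [k k1 fk] _] _ _ x01 y01.
apply: le_trans (fk x y _ _) _; rewrite /= ?in_itv//.
by rewrite ler_piMl// ltW.
Qed.

Let f_inj i x y : 0 <= x <= 1 -> 0 <= y <= 1 -> f i x = f i y -> x = y.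
Proof.
case: fC => /(_ i)[_ _ [_ [h _ hf]]] _ _ x01 y01 e.
by rewrite -[x]hf ?e ?hf//= in_itv.
Qed.

Lemma cantor_map_image_compact (i : 'I_m) (A : set R) : A `<=` `[0, 1] -> compact A -> compact (f i @` A).
Proof.
move=> A01 cA; apply: continuous_compact => //.
apply/subspace_continuousP => x Ax; apply/cvgrPdist_lt => e e0.
rewrite near_withinE; apply/nbhs_ballP; exists e => //= y.
rewrite /ball/= => xy Ay; apply: le_lt_trans xy; apply: f_lip.
  by have := A01 _ Ax; rewrite /= in_itv.
by have := A01 _ Ay; rewrite /= in_itv.
Qed.

Lemma cantor_stage01 n : cantor_stage f n `<=` `[0, 1].
Proof.
elim: n => [//|n IH] _ [i _ [x /IH x01 <-]].
by move: x01; rewrite /= !in_itv/=; exact: cantor_map_stable.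
Qed.

Lemma cantor_stage_compact n : compact (cantor_stage f n).
Proof.
elim: n => [|n IH]; first exact: segment_compact.
rewrite /= (_ : [set: 'I_m] = [set` enum 'I_m]); last first.
  by apply/seteqP; split=> // i _ /=; rewrite mem_enum.
rewrite bigcup_seq; apply: bigsetU_compact => i _.
by apply: cantor_map_image_compact => //; exact: cantor_stage01.
Qed.

Lemma cantor_stageS n : cantor_stage f n.+1 `<=` cantor_stage f n.
Proof.
elim: n => [|n IH]; first exact: (@cantor_stage01 1%N).
by move=> _ [i _ [x /IH x01 <-]]; exists i => //; exists x.
Qed.

Lemma cantor_set_compact : compact C.
Proof.
apply: (@subclosed_compact R C `[0, 1]%classic).
- rewrite CE; apply: closed_bigI => n _.
  by apply: compact_closed; [exact: norm_hausdorff|exact: cantor_stage_compact].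
- exact: segment_compact.
- by rewrite CE => x /(_ 0%N I).
Qed.

Lemma cantor_set01 x : C x -> 0 <= x <= 1.
Proof. by rewrite CE => /(_ 0%N I); rewrite /= in_itv. Qed.

Lemma cantor_set_stable i x : C x -> C (f i x).
Proof.
rewrite CE => Cx n _; apply: cantor_stageS.
by exists i => //; exists x => //; exact: Cx.
Qed.

(** As the images are disjoint, the first letter of [x] is the same at all stages;
    as the maps are injective, so is its preimage, which thus lies in every
    stage. *)
Lemma cantor_set_cover x : C x -> exists i, exists2 y, C y & f i y = x.
Proof.
move=> Cx; have Sx n : cantor_stage f n x by move: Cx; rewrite CE; exact.
have [i _ [y y01 yx]] := Sx 1%N; exists i; exists y => //; rewrite CE => n _.
have [j _ [z zn zx]] := Sx n.+1.
have z01 := cantor_stage01 zn.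
have ij : j = i.
  by apply: f_disj => //; exists x; split; [exists z|exists y].
rewrite ij in zx; rewrite (_ : y = z)//; apply: (@f_inj i).
- by move: y01; rewrite /= in_itv.
- by move: z01; rewrite /= in_itv.
- by rewrite yx zx.
Qed.

(** The set of differences of two disjoint compact images is closed and misses
    zero. *)
Lemma cantor_map_gap : exists2 gap, 0 < gap & forall i j x y, i != j ->
  0 <= x <= 1 -> 0 <= y <= 1 -> gap <= `|f i x - f j y|.
Proof.
suff [e e0 He] : exists2 e : R, 0 < e & forall p : 'I_m * 'I_m, p.1 != p.2 ->
    forall x y, 0 <= x <= 1 -> 0 <= y <= 1 -> e <= `|f p.1 x - f p.2 y|.
  by exists e => // i j x y ij; exact: (He (i, j)).
apply: (@finitely_many_pos _ _ (fun p e => p.1 != p.2 ->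
    forall x y, 0 <= x <= 1 -> 0 <= y <= 1 -> e <= `|f p.1 x - f p.2 y|)); last first.
  by move=> p e e' _ e'e H ij x y x01 y01; apply: (le_trans e'e); exact: H.
move=> [i j] /=; have [->|ij] := eqVneq i j; first by exists 1.
pose A k := f k @` `[0, 1].
have cA k : compact (A k).
  by apply: cantor_map_image_compact => //; exact: segment_compact.
pose S := (fun p => p.1 - p.2) @` (A i `*` A j).
have cS : closed S.
  apply: compact_closed; first exact: norm_hausdorff.
  apply: continuous_compact; last exact: compact_setX.
  by apply: continuous_subspaceT => p; exact: sub_continuous.
have S0 : (~` S) 0.
  move=> [[u v] [/= Au Av] /eqP]; rewrite subr_eq0 => /eqP uv.
  move/negP: ij; apply; apply/eqP; apply: f_disj => //.
  by exists u; split=> //; rewrite uv.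
have : nbhs 0 (~` S) by apply: open_nbhs_nbhs; split=> //; exact: closed_openC.
move=> /nbhs_ballP[e /= e0 He]; exists e => // _ x y x01 y01.
rewrite leNgt; apply/negP => H; apply: (He (f i x - f j y)).
  by rewrite /ball/= sub0r normrN.
exists (f i x, f j y) => //; split=> /=.
  by exists x => //; rewrite /= in_itv.
by exists y => //; rewrite /= in_itv.
Qed.

End CantorSet.

Section DimensionValues.
Context {R : realType}.
Implicit Types A : set R.

Lemma hausdorff_dim_ge0 A : (0 <= hausdorff_dim A)%E.
Proof. by apply: le_ereal_inf_tmp => _ [s [s0 _] <-]; rewrite lee_fin. Qed.

Lemma hausdorff_dim_gt0_nonempty A : (0 < hausdorff_dim A)%E -> A !=set0.
Proof.
move=> dA; apply/set0P/eqP => A0.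
have [s s0 sA] : exists2 s : R, 0 < s & (s%:E < hausdorff_dim A)%E.
  move: dA; case: (hausdorff_dim A) => [r r0|_|//]; last by exists 1; rewrite ?ltry.
  by exists (r / 2); rewrite ?lte_fin; move: r0; rewrite lte_fin; lra.
have [k k0 Hk] := hausdorff_dim_content s0 sA.
have /Hk : interval_cover A [::] by split=> // x; rewrite A0.
by rewrite /cover_cost big_nil leNgt k0.
Qed.

(** Both dimensions are positive as neither exceeds one, so each can be lowered by
    a third of the excess of their sum over one. *)
Lemma hausdorff_dim_split A B : (hausdorff_dim A <= 1)%E -> (hausdorff_dim B <= 1)%E ->
  (1 < hausdorff_dim A + hausdorff_dim B)%E ->
  exists s t : R, [/\ 0 < s < 1, 0 < t < 1, 1 < s + t, (s%:E < hausdorff_dim A)%E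
    & (t%:E < hausdorff_dim B)%E].
Proof.
have := hausdorff_dim_ge0 A; have := hausdorff_dim_ge0 B.
case: (hausdorff_dim A) => [u| |]//; case: (hausdorff_dim B) => [v| |]//.
rewrite !lee_fin -EFinD lte_fin => u0 v0 u1 v1 uv.
exists (u - (u + v - 1) / 3), (v - (u + v - 1) / 3).
by split; rewrite ?lte_fin; try (apply/andP; split); lra.
Qed.

End DimensionValues.

(** * Nearly affine Cantor sets *)
Section WithinFacts.
Context {R : realType}.
Implicit Types (J : set R) (f : R -> R).

Lemma within_continuous_eps J f x e : {within J, continuous f} -> J x -> 0 < e ->
  exists2 eta, 0 < eta & forall l, J l -> `|l - x| <= eta -> `|f l - f x| <= e.
Proof.
move=> /subspace_continuousP cf Jx e0.
have /cvgrPdist_lt/(_ e e0) := cf x Jx; rewrite near_withinE => /nbhs_ballP[d /= d0 H].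
exists (d / 2); first by rewrite divr_gt0.
move=> l Jl ld; rewrite distrC ltW//; apply: (H l) => //.
by rewrite /ball/= distrC; lra.
Qed.

(** Near [x] the function keeps its sign. *)
Lemma derivable_within_norm J f x : J x -> f x != 0 -> derivable_within J f x ->
  derivable_within J (fun t => `|f t|) x.
Proof.
move=> Jx fx0 df; have df' : diff_quotient f x @ within J x^' --> derive_within J f x by [].
apply/cvg_ex; exists (Num.sg (f x) * derive_within J f x).
apply/slope_within_cvgP => e e0.
have [d d0 Hd] := (slope_within_cvgP J f x _).1 df' e e0.
have : f @ within J (nbhs x) --> f x := slope_within_continuous df'.
have fn0 : 0 < `|f x| by rewrite normr_gt0.
move=> /cvgrPdist_lt/(_ _ fn0); rewrite near_withinE => /nbhs_ballP[d' /= d'0 Hd'].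
exists (Num.min d d'); first by rewrite lt_min d0.
move=> y Jy yx; rewrite lt_min => /andP[yd yd'].
have fy : `|f x - f y| < `|f x| by apply: (Hd' y) => //; rewrite /ball/= distrC.
have -> : `|f y| = Num.sg (f x) * f y.
  have [fx|fx|fx] := ltgtP (f x) 0; last by rewrite fx eqxx in fx0.
    rewrite ltr0_sg// mulN1r ltr0_norm//.
    by move: fy; rewrite (ltr0_norm fx) ltr_norml => /andP[? ?]; lra.
  rewrite gtr0_sg// mul1r gtr0_norm//.
  by move: fy; rewrite (gtr0_norm fx) ltr_norml => /andP[? ?]; lra.
rewrite (normrEsg (f x)) -mulrBr -mulrA -mulrBr normrM.
have -> : `|Num.sg (f x)| = 1 by rewrite normr_sg fx0.
by rewrite mul1r; exact: Hd.
Qed.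

End WithinFacts.

(** The size of the perturbation: with [ka = k0 / 2], it is at most [ka / 2] and
    small compared with the speed [Y] of the points of the Cantor set. *)
Lemma perturbation_constants (R : realType) (k0 A0 E e1 delta : R) :
  0 < e1 -> e1 <= 1 -> e1 <= delta -> 0 < k0 -> k0 <= 1 -> 1 <= A0 -> 0 < E ->
  E * A0 = k0 * e1 / 256 ->
  E <= k0 / 2 / 2 /\ E * (2 * ((2 * (2 * A0) + E) / (k0 / 2 / 2)) + 1) <= delta / 2.
Proof.
move=> e10 e11 e1d k00 k01 A01 E0 EA.
have ka20 : 0 < k0 / 2 / 2 by rewrite !divr_gt0.
have k0e1 : k0 * e1 <= k0 by rewrite ler_piMr// ltW.
have k0e1' : k0 * e1 <= e1 by rewrite ler_piMl// ltW.
have EEA : E <= E * A0 by rewrite ler_peMr// ltW.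
split; first by lra.
set Y := _ / _.
have YE : 2 * (2 * A0) + E = Y * (k0 / 2 / 2) by rewrite /Y divfK// gt_eqF.
have EE : E * E <= E * A0 by rewrite ler_wpM2l ?(ltW E0)//; lra.
have h : E * Y * (k0 / 2 / 2) <= 5 * (k0 * e1 / 256) by rewrite -mulrA -YE -EA; lra.
have h' : E * Y <= 20 * e1 / 256 by rewrite -(ler_pM2r ka20); lra.
by lra.
Qed.

Lemma dist_perturbation (R : realType) (gap p q p0 q0 : R) :
  `|q - q0| <= gap / 4 -> `|p - p0| <= gap / 4 -> gap <= `|p0 - q0| ->
  gap / 2 <= `|p - q|.
Proof.
move=> hq hp h; have -> : p - q = (p0 - q0) - ((q - q0) - (p - p0)) by ring.
have := ler_normB (q - q0) (p - p0); have := lerB_dist (p0 - q0) ((q - q0) - (p - p0)).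
lra.
Qed.

Section Main.
Context {R : realType} {m : nat}.
Local Notation mu := (@lebesgue_measure R).
Variables (J : set R) (c b : 'I_m -> R -> R) (delta : R).
Hypothesis hJ : is_interval J.
Hypothesis hc_range : forall i l, J l -> (`]-1, 0[ `|` `]0, 1[) (c i l).
Hypothesis hc : forall i, C1_on J (c i).
Hypothesis hb : forall i, C1_on J (b i).
Hypothesis delta0 : 0 < delta.
Hypothesis hdc : forall i l, J l -> derive_within J (fun t => `|c i t|) l <= - delta.

(** A continuous lower bound for all the distances of [`|c i l|] to 0 and to 1. *)
Definition ratio_margin (l : R) : R := \prod_i (`|c i l| * (1 - `|c i l|)).
Definition speed_bound (l : R) : R :=
  1 + \sum_i (`|derive_within J (c i) l| + `|derive_within J (b i) l|).
(** The bound [eps0] of the theorem. The constant 512 absorbs the factors two lost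
    when, near a point, [ratio_margin], [speed_bound] and this bound itself are
    replaced by bounds taken at that point. *)
Definition perturbation_bound (l : R) : R :=
  ratio_margin l * (Num.min delta 1 / 512) / speed_bound l.

Let c_norm i l : J l -> 0 < `|c i l| < 1.
Proof.
move=> /(hc_range i)[]; rewrite /= in_itv/= => /andP[c1 c2].
  by rewrite ltr0_norm//; apply/andP; split; lra.
by rewrite gtr0_norm// c1.
Qed.

Let margin_factor i l : J l -> 0 < `|c i l| * (1 - `|c i l|) <= 1.
Proof.
move=> /(c_norm i)/andP[c0 c1]; rewrite mulr_gt0 ?subr_gt0//=.
have h : 0 <= 1 - `|c i l| by rewrite subr_ge0 ltW.
have h' : 1 - `|c i l| <= 1 by rewrite gerBl.
by have := ler_pM (normr_ge0 _) h (ltW c1) h'; rewrite mulr1.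
Qed.

Let margin_gt0 l : J l -> 0 < ratio_margin l.
Proof. by move=> Jl; apply: prodr_gt0 => i _; have /andP[] := margin_factor i Jl. Qed.

Let margin_le i l : J l -> ratio_margin l <= `|c i l| <= 1 - ratio_margin l.
Proof.
move=> Jl; have /andP[c0 c1] := c_norm i Jl.
have H : ratio_margin l <= `|c i l| * (1 - `|c i l|).
  rewrite /ratio_margin (bigD1 i)//= ler_piMr//.
    by have /andP[/ltW] := margin_factor i Jl.
  apply: prodr_ile1 => j _; have /andP[h1 h2] := margin_factor j Jl.
  by rewrite (ltW h1).
have H1 : `|c i l| * (1 - `|c i l|) <= `|c i l| by rewrite ler_piMr// ?gerBl// ltW.
have H2 : `|c i l| * (1 - `|c i l|) <= 1 - `|c i l|.
  by rewrite ler_piMl ?subr_ge0 ?(ltW c1).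
by apply/andP; split; lra.
Qed.

Let speed_ge1 l : 1 <= speed_bound l.
Proof. by rewrite lerDl sumr_ge0// => i _; rewrite addr_ge0. Qed.

Let speed_le i l : `|derive_within J (c i) l| <= speed_bound l /\
  `|derive_within J (b i) l| <= speed_bound l.
Proof.
have H : `|derive_within J (c i) l| + `|derive_within J (b i) l| <= speed_bound l.
  rewrite /speed_bound (bigD1 i)//= addrCA lerDl addr_ge0//.
  by apply: sumr_ge0 => j _; exact: addr_ge0.
by split; apply: le_trans H; rewrite ?lerDl ?lerDr.
Qed.

Let cvg_within (f : R -> R) l : {within J, continuous f} -> J l -> f @ within J (nbhs l) --> f l.
Proof. by move=> /subspace_continuousP H /H. Qed.

Let c_cvg i l : J l -> c i @ within J (nbhs l) --> c i l.
Proof. by move=> Jl; apply: slope_within_continuous; exact: (hc i).1. Qed.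

Let ratio_margin_cvg l : J l -> ratio_margin @ within J (nbhs l) --> ratio_margin l.
Proof.
move=> Jl; apply: cvg_big => [|i _]; first exact: mul_continuous.
by apply: cvgM; [|apply: cvgB; first exact: cvg_cst]; apply: cvg_norm; exact: c_cvg.
Qed.

Let speed_bound_cvg l : J l -> speed_bound @ within J (nbhs l) --> speed_bound l.
Proof.
move=> Jl; apply: cvgD; first exact: cvg_cst.
apply: cvg_big => [|i _]; first exact: add_continuous.
by apply: cvgD; apply: cvg_norm; apply: cvg_within => //; [exact: (hc i).2|exact: (hb i).2].
Qed.

Lemma perturbation_bound_continuous : {within J, continuous perturbation_bound}.
Proof.
apply/subspace_continuousP => l Jl; apply: cvgM.
  by apply: cvgM; [exact: ratio_margin_cvg|exact: cvg_cst].
apply: cvgV; last exact: speed_bound_cvg.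
by rewrite gt_eqF// (lt_le_trans ltr01).
Qed.

Lemma perturbation_bound_gt0 l : J l -> 0 < perturbation_bound l.
Proof.
move=> Jl; have d1 : 0 < Num.min delta 1 by rewrite lt_min delta0 ltr01.
have h512 : 0 < 512 :> R by rewrite ltr0n.
apply: divr_gt0; last exact: lt_le_trans ltr01 (speed_ge1 l).
apply: mulr_gt0; [exact: margin_gt0|exact: divr_gt0 d1 h512].
Qed.

Variables (g : 'I_m -> R * R -> R) (C : R -> set R) (K : set R).
Hypothesis hg : forall i, C2_on2 `[0, 1] J (g i).
Hypothesis hgeps : forall i p, (`[0, 1] `*` J) p ->
  all (fun h => `|h p| <= perturbation_bound p.2) (partials_upto2 `[0, 1] J (g i)).
Let F i l x := c i l * x + b i l + g i (x, l).
Hypothesis hgen : forall l, J l -> generates_cantor_set (fun i => F i l) (C l).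
Hypothesis cK : compact K.
Hypothesis hdim : forall l, J l -> (1 < hausdorff_dim K + hausdorff_dim (C l))%E.

Let dimC_le1 l : J l -> (hausdorff_dim (C l) <= 1)%E.
Proof.
move=> Jl; apply: (@hausdorff_dim_bounded _ _ 1) => x /(cantor_set01 (hgen Jl)).
by rewrite /= in_itv/= => /andP[? ?]; apply/andP; split; lra.
Qed.

Let dimK_le1 : (hausdorff_dim K <= 1)%E.
Proof.
have [N [_ KN]] := compact_bounded cK.
apply: (@hausdorff_dim_bounded _ _ (N + 1)) => x Kx; rewrite /= in_itv/= -ler_norml.
by apply: KN Kx; rewrite ltrDl.
Qed.

(** In a small interval around [l0] the bounds at [l0], up to a factor two, serve
    for all parameters, the signs of the [c i] are constant, and the gap between
    the images of the maps keeps half of its size. *)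
Lemma local_sumset_ae l0 u v : J u -> J v -> u < l0 < v ->
  exists a' b', a' < l0 < b' /\
  {ae mu, forall l, a' <= l <= b' -> (0 < mu [set (x + y)%R | x in K & y in C l])%E}.
Proof.
move=> Ju Jv /andP[ul0 l0v].
have J0 : J l0 by apply: (hJ Ju Jv); apply/andP; split; exact: ltW.
have [s [t' [s01 t'01 st' sK tC]]] := hausdorff_dim_split dimK_le1 (dimC_le1 J0) (hdim J0).
have [s0 s1] : 0 < s /\ s < 1 by case/andP: s01.
have [t'0 t'1] : 0 < t' /\ t' < 1 by case/andP: t'01.
have [kK kK0 HK] := hausdorff_dim_content s0 sK.
have [kC kC0 HC] := hausdorff_dim_content t'0 tC.
have Cne l : J l -> C l !=set0.
  move=> Jl; have [_ [t [_ /andP[t0 _] _ _ tCl]]] :=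
    hausdorff_dim_split dimK_le1 (dimC_le1 Jl) (hdim Jl).
  by apply: hausdorff_dim_gt0_nonempty; apply: lt_trans tCl; rewrite lte_fin.
set k0 := ratio_margin l0; set A0 := speed_bound l0; set e0 := perturbation_bound l0.
have k00 : 0 < k0 by exact: margin_gt0.
have A01 : 1 <= A0 by exact: speed_ge1.
have e00 : 0 < e0 by exact: perturbation_bound_gt0.
pose ka := k0 / 2; pose A := 2 * A0; pose E := 2 * e0.
pose Y := (2 * A + E) / (ka / 2).
pose sg i := Num.sg (c i l0).
have [gap gap0 Hgap] := cantor_map_gap (hgen J0).
have [eta1 eta10 H1] := within_continuous_eps (e := k0 / 2)
  ((subspace_continuousP _ _).2 ratio_margin_cvg) J0 ltac:(by rewrite divr_gt0).
have [eta2 eta20 H2] := within_continuous_eps (e := A0)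
  ((subspace_continuousP _ _).2 speed_bound_cvg) J0 ltac:(by apply: lt_le_trans A01).
have [eta3 eta30 H3] := within_continuous_eps perturbation_bound_continuous J0 e00.
have [eta4 eta40 H4] : exists2 e, 0 < e &
    forall i l, J l -> `|l - l0| <= e -> `|c i l - c i l0| <= k0 / 2.
  apply: (@finitely_many_pos _ _ (fun i e => forall l, J l -> `|l - l0| <= e ->
    `|c i l - c i l0| <= k0 / 2)) => [i|i e e' _ e'e H l Jl le].
    apply: within_continuous_eps => //; last by rewrite divr_gt0.
    by apply/subspace_continuousP; exact: c_cvg.
  by apply: H => //; exact: le_trans e'e.
have k01 : k0 <= 1.
  apply: prodr_ile1 => j _; have /andP[h1 h2] := margin_factor j J0.
  by rewrite (ltW h1).
pose e1 := Num.min delta 1.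
have [e10 e1d e11] : [/\ 0 < e1, e1 <= delta & e1 <= 1].
  by rewrite lt_min delta0 ltr01 !ge_min !lexx orbT.
have A00 : 0 < A0 by exact: lt_le_trans ltr01 A01.
have ka0 : 0 < ka by rewrite divr_gt0.
have ka20 : 0 < ka / 2 by rewrite divr_gt0.
have E0 : 0 < E by rewrite mulr_gt0.
have EA : E * A0 = k0 * e1 / 256.
  have n512 : (512 : R) != 0 by rewrite pnatr_eq0.
  have n256 : (256 : R) != 0 by rewrite pnatr_eq0.
  by rewrite /E /e0 /perturbation_bound -/k0 -/A0 -/e1; field; rewrite ?n256 ?n512 ?(gt_eqF A00).
have [Eka EY] : E <= ka / 2 /\ E * (2 * Y + 1) <= delta / 2.
  exact: perturbation_constants e10 e11 e1d k00 k01 A01 E0 EA.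
have YE : 2 * A + E = Y * (ka / 2) by rewrite /Y divfK// gt_eqF.
have Y0 : 0 <= Y by rewrite divr_ge0// ?(ltW ka20)// addr_ge0 ?(ltW E0)// !mulr_ge0// ltW.
pose eta := Num.min (Num.min (Num.min eta1 eta2) (Num.min eta3 eta4))
  (Num.min (Num.min (l0 - u) (v - l0)) (Num.min (Num.min 2^-1 (delta + 1)^-1) (gap / (4 * (Y + 1))))).
have Y1 : 0 < 4 * (Y + 1) by rewrite mulr_gt0// ltr_wpDl.
have delta1 : 0 < delta + 1 by rewrite addr_gt0.
have eta0 : 0 < eta.
  by rewrite !lt_min eta10 eta20 eta30 eta40 !subr_gt0 ul0 l0v !invr_gt0 delta1 divr_gt0//= ltr0n.
have : eta <= eta by [].
rewrite [in X in _ <= X]/eta !le_min => /andP[/andP[/andP[le1 le2] /andP[le3 le4]]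
  /andP[/andP[leu lev] /andP[/andP[le5 le6] le7]]].
pose la := l0 - eta; pose lb := l0 + eta.
have near l : la <= l <= lb -> `|l - l0| <= eta by rewrite ler_distl.
have inJ l : la <= l <= lb -> J l.
  move=> /andP[h1 h2]; apply: (hJ Ju Jv); apply/andP; split.
    by apply: le_trans h1; rewrite lerBrDr -lerBrDl.
  by apply: (le_trans h2); rewrite -lerBrDl.
have abJ : `[la, lb] `<=` J by move=> l; rewrite /= in_itv/=; exact: inJ.
have sgc i l : la <= l <= lb -> sg i * c i l = `|c i l|.
  move=> lab; have /andP[c00 _] := margin_le i J0.
  have hcl := H4 i l (inJ l lab) (le_trans (near l lab) le4).
  have sg1 : `|sg i| = 1.
    by rewrite normr_sg -normr_gt0 (lt_le_trans k00).
  have sgc0 : sg i * c i l0 = `|c i l0| by rewrite [RHS]normrEsg.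
  have : `|sg i * (c i l - c i l0)| <= k0 / 2 by rewrite normrM sg1 mul1r.
  rewrite mulrBr sgc0 ler_distl => /andP[h _].
  have <- : `|sg i * c i l| = `|c i l| by rewrite normrM sg1 mul1r.
  rewrite ger0_norm//; apply: le_trans h; rewrite subr_ge0.
  by apply: le_trans c00; rewrite ler_pdivrMr// ler_peMr ?(ltW k00)// ler1n.
have sg2 i : sg i ^+ 2 = 1.
  rewrite sqr_sg; have /andP[c00 _] := margin_le i J0.
  by rewrite -normr_gt0 (lt_le_trans k00).
have c_sign i l : la <= l <= lb -> ka <= sg i * c i l <= 1 - ka.
  move=> lab; rewrite sgc//; have /andP[h1 h2] := margin_le i (inJ l lab).
  have := H1 l (inJ l lab) (le_trans (near l lab) le1); rewrite -/k0 ler_distl => /andP[h3 _].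
  have kam : ka <= ratio_margin l by apply: le_trans h3; rewrite {1}(splitr k0) addrK.
  by rewrite (le_trans kam)//= (le_trans h2)// lerB.
have c_decr i l l' : la <= l <= lb -> la <= l' <= lb -> l <= l' ->
    sg i * c i l' <= sg i * c i l - delta * (l' - l).
  move=> lab l'ab; rewrite le_eqVlt => /orP[/eqP <-|ll']; first by rewrite subrr mulr0 subr0.
  rewrite !sgc//.
  have dabs x : J x -> diff_quotient (fun t => `|c i t|) x @ within J x^' -->
      derive_within J (fun t => `|c i t|) x.
    move=> Jx; apply: derivable_within_norm => //; last exact: (hc i).1.
    by have /andP[+ _] := c_norm i Jx; rewrite normr_gt0.
  have ll'J : `[l, l'] `<=` J.
    move=> x; rewrite /= in_itv/= => /andP[lx xl']; apply: inJ.
    move: lab l'ab => /andP[lal _] /andP[_ l'lb].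
    by rewrite (le_trans lal)//= (le_trans xl').
  have [x /andP[lx xl'] e] := MVT_slope_within ll' ll'J dabs.
  have Jx : J x by apply: ll'J; rewrite /= in_itv/= !ltW.
  have l'l0 : 0 <= l' - l by rewrite subr_ge0 ltW.
  by rewrite -mulNr -lerBlDl e; exact: (ler_wpM2r l'l0 (hdc i Jx)).
have sA l : la <= l <= lb -> speed_bound l <= A.
  move=> lab; have := H2 l (inJ l lab) (le_trans (near l lab) le2).
  by rewrite -/A0 ler_distl /A mulr_natl mulr2n => /andP[].
have c_lip i l l' : la <= l <= lb -> la <= l' <= lb -> `|c i l - c i l'| <= A * `|l - l'|.
  apply: (lipschitz_within abJ (hc i).1) => x xab.
  exact: le_trans (speed_le i x).1 (sA x xab).
have b_lip i l l' : la <= l <= lb -> la <= l' <= lb -> `|b i l - b i l'| <= A * `|l - l'|.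
  apply: (lipschitz_within abJ (hb i).1) => x xab.
  exact: le_trans (speed_le i x).2 (sA x xab).
have eE l : la <= l <= lb -> perturbation_bound l <= E.
  move=> lab; have := H3 l (inJ l lab) (le_trans (near l lab) le3).
  by rewrite -/e0 ler_distl /E mulr_natl mulr2n => /andP[].
have g_bounds i x l : 0 <= x <= 1 -> la <= l <= lb ->
    [/\ `|partial1 `[0, 1] (g i) (x, l)| <= E, `|partial2 J (g i) (x, l)| <= E,
        `|partial1 `[0, 1] (partial1 `[0, 1] (g i)) (x, l)| <= E &
        `|partial2 J (partial1 `[0, 1] (g i)) (x, l)| <= E].
  move=> x01 lab; have p01 : (`[0, 1] `*` J) (x, l).
    by split; [rewrite /= in_itv|exact: inJ].
  have := hgeps i p01; rewrite /= => /and4P[_ h1 h2 /and4P[h3 _ h4 _]].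
  by split; apply: le_trans (eE l lab).
have g_lip i (x l l' : R) : 0 <= x <= 1 -> la <= l <= lb -> la <= l' <= lb ->
    `|g i (x, l) - g i (x, l')| <= E * `|l - l'|.
  move=> x01; apply: (@lipschitz_within _ J (fun y => g i (x, y))) => // y.
    by move=> Jy; case: (hg i) => -[/(_ (x, y)) H _ _] _ _; apply: (H _).2; split => //=; rewrite in_itv.
  by move=> yab; have [_ h _ _] := g_bounds i x y x01 yab.
have g_der i l : la <= l <= lb -> forall x : R, `[0, 1]%classic x ->
    derivable_within `[0, 1] (fun x => g i (x, l)) x.
  move=> lab x x01; case: (hg i) => -[/(_ (x, l)) H _ _] _ _; apply: (H _).1.
  by split => //=; exact: inJ.
have g_der_le i (x l : R) : 0 <= x <= 1 -> la <= l <= lb ->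
    `|partial1 `[0, 1] (g i) (x, l)| <= E.
  by move=> x01 lab; have [] := g_bounds i x l x01 lab.
have g_der_lip i (x y l l' : R) : 0 <= x <= 1 -> 0 <= y <= 1 ->
    la <= l <= lb -> la <= l' <= lb ->
    `|partial1 `[0, 1] (g i) (x, l) - partial1 `[0, 1] (g i) (y, l')|
      <= E * (`|x - y| + `|l - l'|).
  move=> x01 y01 lab l'ab.
  have [_ [H _ _] _] := hg i.
  rewrite -(subrKA (partial1 `[0, 1] (g i) (y, l))) mulrDr.
  apply: le_trans (ler_normD _ _) _; apply: lerD.
    apply: (@lipschitz_within _ `[0, 1] (fun z => partial1 `[0, 1] (g i) (z, l)) 0 1) => // z z01.
      by have [] := H (z, l) (conj z01 (inJ l lab)).
    by have [_ _ h _] := g_bounds i z l z01 lab.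
  apply: (@lipschitz_within _ J (fun z => partial1 `[0, 1] (g i) (y, z)) la lb) => // z.
    by move=> Jz; have [] := H (y, z) (conj y01 Jz).
  by move=> zab; have [_ _ _ h] := g_bounds i y z y01 zab.
have F_stable i (l x : R) : la <= l <= lb -> 0 <= x <= 1 -> 0 <= F i l x <= 1.
  by move=> lab; exact: (cantor_map_stable (hgen (inJ l lab)) i).
have AY : 2 * A + E <= Y * (ka / 2) by rewrite YE.
have F_pm i : parametrized_map la lb Y (delta / 2) 1 (F i).
  exact: (nearly_affine_parametrized_map ka0 delta0 (ltW E0) Eka EY AY (sg2 i) (c_sign i)
    (c_decr i) (c_lip i) (b_lip i) (g_lip i) (g_der i) (g_der_le i) (g_der_lip i) (F_stable i)).
have F_ratio i : ratio_between la lb (ka / 2) (1 - ka / 2) (F i).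
  exact: (nearly_affine_ratio (b i) ka0 Eka (sg2 i) (c_sign i) (g_der i) (g_der_le i)).
have A_ge0 : 0 <= A by rewrite /A mulr_ge0// ltW.
have F_dist i : distortion_le la lb ((A + E) / (ka / 2)) 1 1 (F i).
  exact: (nearly_affine_distortion (b i) ka0 A_ge0 (ltW E0) Eka (sg2 i) (c_sign i) (c_lip i)
    (g_der i) (g_der_le i) (g_der_lip i)).
have l0lab : la <= l0 <= lb by rewrite gerBl lerDl (ltW eta0).
have move_le i l x : la <= l <= lb -> 0 <= x <= 1 -> `|F i l x - F i l0 x| <= gap / 4.
  move=> lab x01.
  have h0 : `|x - x| <= Y * `|l - l0| by rewrite subrr normr0 mulr_ge0.
  apply: le_trans (pm_cone (F_pm i) lab l0lab x01 x01 h0) _.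
  apply: (@le_trans _ _ ((Y + 1) * (gap / (4 * (Y + 1))))).
    by rewrite ler_pM// ?lerDl// (le_trans (near l lab)).
  have Y10 : Y + 1 != 0 by rewrite gt_eqF// ltr_wpDl.
  by rewrite le_eqVlt; apply/orP; left; apply/eqP; field.
have F_gap i j l x y : i != j -> la <= l <= lb -> 0 <= x <= 1 -> 0 <= y <= 1 ->
    gap / 2 <= `|F i l x - F j l y|.
  move=> ij lab x01 y01.
  have := Hgap i j x y ij x01 y01; have := move_le i l x lab x01; have := move_le j l y lab y01.
  set p := F i l x; set q := F j l y; set p0 := F i l0 x; set q0 := F j l0 y.
  exact: dist_perturbation.
have lba : lb - la = 2 * eta by rewrite /lb /la; ring.
have la_lt : la < l0 < lb by rewrite gtrBl ltrDl eta0.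
apply: (@letters_sumset_ae R _ la lb l0 Y (delta / 2) (ka / 2) (1 - ka / 2)
  ((A + E) / (ka / 2)) (gap / 2) F _ la_lt _ _ Y0 _ F_pm F_ratio _ _ F_dist _ F_gap
  K kK kC s t' C cK kK0 kC0 HK HC).
- rewrite lba mulrC -ler_pdivlMr//; first by rewrite mul1r.
- rewrite lba mulrA divfK//.
  apply: (@le_trans _ _ ((delta + 1) * (delta + 1)^-1)); last by rewrite divff// gt_eqF.
  by apply: ler_pM => //; rewrite ?lerDl// ltW.
- by rewrite divr_gt0.
- by rewrite divr_ge0// ?(ltW ka20)// addr_ge0// ltW.
- by rewrite ka20 /= /ka -mulrA -invfM ler_pdivrMr ?mulr_gt0// (le_trans k01)// mul1r -natrM ler1n.
- have h : ka / 2 < 1.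
    by rewrite /ka -mulrA -invfM ltr_pdivrMr ?mulr_gt0// (le_lt_trans k01)// mul1r -natrM ltr1n.
  by rewrite subr_gt0 h /= ltrBlDr ltrDl.
- by rewrite divr_gt0.
- by move=> l /inJ Jl; exact: cantor_set_compact (hgen Jl).
- by move=> l /inJ; exact: Cne.
- by move=> l x /inJ Jl; exact: (cantor_set01 (hgen Jl)).
- by move=> i l x /inJ Jl; exact: (cantor_set_stable (hgen Jl) i).
- by move=> x; exact: (cantor_set_cover (hgen J0)).
- by rewrite s0 ltW.
- by rewrite t'0.
- exact: st'.
Qed.

Let good l := (0 < mu [set (x + y)%R | x in K & y in C l])%E.

(** Every point of [J] other than a minimum or a maximum of [J] has a neighborhood
    with rational ends where the conclusion holds almost everywhere; the remaining
    points are at most two. *)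
Lemma global_sumset_ae : {ae mu, forall l, J l -> good l}.
Proof.
pose bad := [set l | J l /\ ~ good l].
pose lmin := [set l | J l /\ forall y, J y -> l <= y].
pose lmax := [set l | J l /\ forall y, J y -> y <= l].
have neg1 (A : set R) : (forall x y, A x -> A y -> x = y) -> mu.-negligible A.
  move=> A1; have [->|/set0P[x Ax]] := eqVneq A set0; first exact: negligible_set0.
  apply: (@negligibleS _ _ R mu [set x] A) => [y Ay|]; first exact: A1.
  by exists [set x]; split => //; exact: lebesgue_measure_set1.
pose piece (p : rat * rat) := bad `&` `]ratr p.1, ratr p.2[.
pose B n := if unpickle n is Some p then
  (if `[< mu.-negligible (piece p) >] then piece p else set0) else set0.
have negB n : mu.-negligible (B n).
  rewrite /B; case: (unpickle n) => [p|]; last exact: negligible_set0.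
  by case: asboolP => // _; exact: negligible_set0.
apply: (@negligibleS _ _ R mu (lmin `|` (lmax `|` \bigcup_n B n))); last first.
  apply: negligibleU; last apply: negligibleU; last exact: negligible_bigcup.
    by apply: neg1 => x y [Jx Hx] [Jy Hy]; apply/eqP; rewrite eq_le Hx// Hy.
  by apply: neg1 => x y [Jx Hx] [Jy Hy]; apply/eqP; rewrite eq_le Hx// Hy.
move=> l /= Hl.
have [Jl ngl] : J l /\ ~ good l.
  by apply: contrapT => H; apply: Hl => Jl; apply: contrapT => ngl; apply: H.
have [Hmin|] := pselect (lmin l); first by left.
move=> Hmin; right; have [Hmax|Hmax] := pselect (lmax l); first by left.
right.
have [u Ju ul] : exists2 u, J u & u < l.
  apply: contrapT => H; apply: Hmin; split=> // y Jy; rewrite leNgt; apply/negP => yl.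
  by apply: H; exists y.
have [v Jv lv] : exists2 v, J v & l < v.
  apply: contrapT => H; apply: Hmax; split=> // y Jy; rewrite leNgt; apply/negP => yl.
  by apply: H; exists y.
have ulv : u < l < v by rewrite ul.
have [a' [b' [/andP[a'l lb'] ae]]] := local_sumset_ae Ju Jv ulv.
have /rat_in_itvoo[p] := a'l; have /rat_in_itvoo[q] := lb'.
rewrite !in_itv/= => /andP[lq qb'] /andP[a'p pl].
have negp : mu.-negligible (piece (p, q)).
  apply: negligibleS ae => x [[Jx ngx]]; rewrite /= in_itv/= => /andP[px xq] H.
  by apply: ngx; apply: H; rewrite (ltW (lt_trans a'p px)) ltW// (lt_trans xq).
have [n nE] : exists n, unpickle n = Some (p, q).
  by exists (pickle (p, q)); exact: pickleK.
exists n; first by []; rewrite /B nE; case: asboolP => // _.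
by split; [split|rewrite /= in_itv/= pl].
Qed.

End Main.

Theorem theorem1p1 (R : realType) (m : nat) (hm : (2 <= m)%N)
    (J : set R) (hJ : is_interval J)
    (c b : 'I_m -> R -> R)
    (hc_range : forall i l, J l -> (`]-1, 0[ `|` `]0, 1[) (c i l))
    (hc : forall i, C1_on J (c i))
    (hb : forall i, C1_on J (b i))
    (hdc : exists2 delta : R, 0 < delta &
       forall i l, J l -> derive_within J (fun t => `|c i t|) l <= - delta) :
  exists eps0 : R -> R,
    [/\ {within J, continuous eps0},
        forall l, J l -> 0 < eps0 l
      & forall (g : 'I_m -> R * R -> R) (C : R -> set R),
          (forall i, C2_on2 `[0, 1] J (g i)) ->
          (forall i p, (`[0, 1] `*` J) p ->
             all (fun h => `|h p| <= eps0 p.2)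
                 (partials_upto2 `[0, 1] J (g i))) ->
          (forall l, J l ->
             generates_cantor_set
               (fun i x => c i l * x + b i l + g i (x, l)) (C l)) ->
          forall K : set R, compact K ->
            (forall l, J l -> (1 < hausdorff_dim K + hausdorff_dim (C l))%E) ->
            {ae @lebesgue_measure R, forall l, J l ->
               (0 < lebesgue_measure [set (x + y)%R | x in K & y in C l])%E}].
Proof.
have [delta delta0 hdc'] := hdc.
exists (perturbation_bound J c b delta); split.
- exact: perturbation_bound_continuous.
- exact: perturbation_bound_gt0.
- move=> g C hg hgeps hgen K cK hdim.
  exact: (global_sumset_ae hJ hc_range hc hb delta0 hdc' hg hgeps hgen cK hdim).
Qed.
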